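(* Let $$I_C(x)=\begin{cases} x-\log(x+1), & \text{if } x>-1,\\ +\infty, & \text{if } x\leq -1.\end{cases}$$ (i) Let $\{d_n:n\geq1\}$ be the digit sequence of the modified Engel's series, viewed as random variables on $(0,1)$ with its Borel $\sigma$-algebra and Lebesgue measure. Then the sequence $\left\{\frac{\log d_n-n}{n}:n\geq1\right\}$ satisfies a large deviation principle with speed $n$ and good rate function $I_C$. (ii) Let $\{X_n:n\geq1\}$ be a sequence of independent and identically distributed real-valued random variables with a common continuous distribution function on a probability space $(\Omega,\mathcal{F},\mathbf{P})$, and let $\{L_n:n\geq 1\}$ be its record times. Then the sequence $\left\{\frac{\log L_n-n}{n}:n\geq1\right\}$ satisfies a large deviation principle with speed $n$ and good rate function $I_C$.
   Context: Modified Engel's series: each $x\in(0,1)$ is expanded (uniquely) as the infinite series $$x=\frac{1}{d_1}+\frac{1}{(d_1-1)d_2}+\cdots+\frac{1}{(d_1-1)\cdots(d_{n-1}-1)d_n}+\cdots,$$ where the $d_n=d_n(x)\geq2$ are integers with $d_{n+1}\geq d_n+1$ for all $n\in\mathbb{N}=\{1,2,3,\dots\}$; the sequence $\{d_n:n\ge1\}$ is the digit sequence. Record times: $L_0=1$ and $L_{n+1}=\min\{j: X_j>X_{L_n},\ j>L_n\}$ for all $n\geq0$ (these are finite almost surely). Large deviation principle: A function $I:\mathbb{R}\to[0,\infty]$ is a good rate function if it is lower semicontinuous and has compact level sets (i.e. $\{x\in\mathbb{R}: I(x)\le\alpha\}$ is compact for every $\alpha\in[0,\infty)$). A sequence $\{Y_n:n\geq1\}$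 of real-valued random variables on a probability space with probability measure $\mathbf{P}$ satisfies a large deviation principle with speed $n$ and good rate function $I$ if $I$ is a good rate function and, for every Borel set $\Gamma\subseteq\mathbb{R}$, $$-\inf_{x\in\Gamma^\circ}I(x)\leq\liminf_{n\to\infty}\frac1n\log\mathbf{P}(Y_n\in\Gamma)\leq\limsup_{n\to\infty}\frac1n\log\mathbf{P}(Y_n\in\Gamma)\leq-\inf_{x\in\overline{\Gamma}}I(x),$$ where $\Gamma^\circ$ and $\overline{\Gamma}$ denote the interior and the closure of $\Gamma$; the conventions are $\log 0=-\infty$ and $\inf\emptyset=+\infty$. Here $\log$ is the natural logarithm. *)

(* Defs.v *)
From HB Require Import structures.
From mathcomp Require Import all_boot all_order all_algebra finmap.
From mathcomp Require Import all_classical all_reals all_analysis.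

Set Implicit Arguments.
Unset Strict Implicit.
Unset Printing Implicit Defensive.

Import Order.TTheory GRing.Theory Num.Theory.
Import numFieldNormedType.Exports.

Local Open Scope classical_set_scope.
Local Open Scope ring_scope.

(* All sequences [u_1, u_2, ...] are functions on [nat];
   the value at 0 is never used (record times excepted: these start at L_0 = 1). *)

Definition good_rate_function (R : realType) (I : R -> \bar R) : Prop :=
  [/\ forall x, (0 <= I x)%E,
      lower_semicontinuous I &
      forall a : R, 0 <= a -> compact [set x | (I x <= a%:E)%E] ].

(* The probability space is the measurable subset [D] of [T] with the
   restriction of [mu] (so [mu D = 1] in all uses); [measurable_fun D (Y n)]
   says that the [Y n] are random variables on it. With the library's
   conventions [lne 0 = -oo] and [ereal_inf set0 = +oo]. *)
Definition satisfies_LDP (d : measure_display) (T : measurableType d)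
    (R : realType) (mu : {measure set T -> \bar R}) (D : set T)
    (Y : nat -> T -> R) (I : R -> \bar R) : Prop :=
  let u (Gamma : set R) (n : nat) : \bar R :=
    ((n%:R^-1)%:E * lne (mu (D `&` Y n @^-1` Gamma)))%E in
  [/\ good_rate_function I,
      forall n, (1 <= n)%N -> measurable_fun D (Y n) &
      forall Gamma : set R, measurable Gamma ->
        [/\ (- ereal_inf (I @` Gamma°) <= limn_einf (u Gamma))%E,
            (limn_einf (u Gamma) <= limn_esup (u Gamma))%E &
            (limn_esup (u Gamma) <= - ereal_inf (I @` closure Gamma))%E ] ].

Definition I_C (R : realType) (x : R) : \bar R :=
  if -1 < x then (x - ln (x + 1))%:E else +oo%E.

Definition engel_expansion (R : realType) (x : R) (e : nat -> nat) : Prop :=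
  [/\ forall n, (1 <= n)%N -> (2 <= e n)%N,
      forall n, (1 <= n)%N -> (e n + 1 <= e n.+1)%N &
      (fun N => \sum_(1 <= n < N.+1)
         ((\prod_(1 <= k < n) ((e k)%:R - 1)) * (e n)%:R)^-1) @ \oo --> x ].

(* For [0 < x < 1] the terms of index [n >= 1] of the expansion exist and are
   unique, hence do not depend on the choice made by [xget]. *)
Definition engel_digits (R : realType) (x : R) : nat -> nat :=
  xget (fun=> 0%N) [set e | engel_expansion x e].

Definition next_record (R : realType) (x : nat -> R) (l : nat) : option nat :=
  match pselect (exists j, (l < j)%N && (x l < x j)) with
  | left ex => Some (ex_minn ex)
  | right _ => None
  end.

(* [None] stands for an infinite record time. *)
Fixpoint record_time_opt (R : realType) (x : nat -> R) (n : nat) : option nat :=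
  if n is m.+1 then obind (next_record x) (record_time_opt x m) else Some 1%N.

(* Infinite record times, which have probability 0 in the i.i.d. continuous
   case, are given the arbitrary value 0. *)
Definition record_time (R : realType) (x : nat -> R) (n : nat) : nat :=
  odflt 0%N (record_time_opt x n).

Section iid.
Context (d : measure_display) (T : measurableType d) (R : realType).
Variable P : probability T R.

Definition mutually_independent (X : nat -> {RV P >-> R}) : Prop :=
  forall (J : {fset nat}) (B : nat -> set R),
    (forall j, j \in J -> (1 <= j)%N) ->
    (forall j, measurable (B j)) ->
    P (\bigcap_(j in [set` J]) (X j @^-1` B j)) =
    (\prod_(j <- J) P (X j @^-1` B j))%E.

Definition identically_distributed (X : nat -> {RV P >-> R}) : Prop :=
  forall i j, (1 <= i)%N -> (1 <= j)%N -> forall B : set R, measurable B ->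
    distribution P (X i) B = distribution P (X j) B.

End iid.

(* Main.v *)
Require Import Defs.
From HB Require Import structures.
From mathcomp Require Import all_boot all_order all_algebra finmap.
From mathcomp Require Import all_classical all_reals all_analysis.
From mathcomp Require Import ring lra zify.

(* Both sequences have the same marginals: [d_n] and [L_n] are distributed as
   the [n]-th state of the Markov chain on [{1, 2, ...}] started at 1 that jumps
   from [j] to [k > j] with probability [j / (k (k - 1))]. For the digits, on
   [{d_n = k}] the rescaled remainder is uniform on [(0, 1/k]]; for the record
   times, the number of records among the first [m] observations is independent
   of their maximum. For every [c > 0] the function
   [k |-> k * \prod_(i < k) i / (i + c)] is an eigenfunction of the chain for
   the eigenvalue [1 / c] and is comparable to [k `^ (1 - c)], so that
   [log d_n] and [log L_n] have, up to constants, the exponential moments of a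
   sum of [n] independent Exp(1) variables. Cramer's argument (exponential
   Markov inequality and change of measure) then gives the rate function
   [x - log (x + 1)]. *)

Set Implicit Arguments.
Unset Strict Implicit.
Unset Printing Implicit Defensive.

Import Order.TTheory GRing.Theory Num.Theory.
Import numFieldNormedType.Exports.

Local Open Scope classical_set_scope.
Local Open Scope ring_scope.

(** * A Markov chain and its eigenfunctions *)

Section law.
Context {R : realType}.
Implicit Types (n k : nat) (c : R).

(* Law after [n] steps of the Markov chain on [{1, 2, ...}] started at 1 that
   jumps from [j] to [k > j] with probability [j / (k (k - 1))]. *)
Fixpoint law n k : R :=
  if n is m.+1 then (\sum_(j < k) law m j * j%:R) / (k%:R * (k%:R - 1))
  else (k == 1)%:R.

Lemma law_ge0 n k : 0 <= law n k.
Proof.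
elim: n k => [|n IH] k /=; first by rewrite ler0n.
case: k => [|k]; first by rewrite big_ord0 mul0r.
apply: divr_ge0; first by apply: sumr_ge0 => j _; rewrite mulr_ge0.
by rewrite mulr_ge0 // subr_ge0 ler1n.
Qed.

Lemma law0r n : law n 0 = 0.
Proof. by case: n => //= n; rewrite big_ord0 mul0r. Qed.

Lemma lawS1 n : law n.+1 1 = 0.
Proof. by rewrite /= subrr mulr0 invr0 mulr0. Qed.

Definition ratio c k : R := \prod_(1 <= i < k) (i%:R / (i%:R + c)).

(* [weight c] is an eigenfunction of the chain for the eigenvalue [c^-1]; it
   grows like [k `^ (1 - c)]. *)
Definition weight c k : R := k%:R * ratio c k.

Lemma ratioS c k : (1 <= k)%N -> ratio c k.+1 = ratio c k * (k%:R / (k%:R + c)).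
Proof. by move=> k1; rewrite /ratio big_nat_recr. Qed.

Lemma ratio1 c : ratio c 1 = 1.
Proof. by rewrite /ratio big_geq. Qed.

Lemma ratio_gt0 c k : 0 < c -> 0 < ratio c k.
Proof.
move=> c0; rewrite /ratio big_nat; apply: prodr_gt0 => i /andP[i1 _].
by rewrite divr_gt0// ?ltr0n// ltr_wpDl.
Qed.

Lemma weight_ge0 c k : 0 < c -> 0 <= weight c k.
Proof. by move=> c0; rewrite mulr_ge0// ltW// ratio_gt0. Qed.

Lemma weight_gt0 c k : 0 < c -> (1 <= k)%N -> 0 < weight c k.
Proof. by move=> c0 k1; rewrite mulr_gt0 ?ltr0n// ratio_gt0. Qed.

Lemma weight1 k : (1 <= k)%N -> weight 1 k = 1.
Proof.
elim: k => // -[|k] IH _; rewrite /weight; first by rewrite ratio1 mulr1.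
rewrite ratioS// natr1 -[RHS](IH isT) /weight.
have : k.+2%:R != 0 :> R by rewrite pnatr_eq0.
by move: k.+2%:R => x x0; field.
Qed.

Lemma weightS c k : 0 < c -> (1 <= k)%N ->
  weight c k.+1 = weight c k * ((k%:R + 1) / (k%:R + c)).
Proof.
move=> c0 k1; rewrite /weight ratioS// -natr1; field.
by rewrite gt_eqF// ltr_wpDl.
Qed.

Lemma lnB_le (x y : R) : 0 < x -> 0 < y -> ln x - ln y <= x / y - 1.
Proof.
move=> x0 y0; rewrite -ln_div ?posrE//.
have := @le_ln1Dx _ (x / y - 1).
by rewrite [1 + _]addrC subrK; apply; rewrite ltrBrDl subrr divr_gt0.
Qed.

Lemma ln_bernoulli_le (a t : R) : 0 < a -> 0 <= t <= 1 ->
  (1 - t) * ln a + t * ln (a + 1) <= ln (a + t).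
Proof.
move=> a0 /andP[t0 t1].
have at0 : 0 < a + t by lra.
have a1 : 0 < a + 1 by lra.
have E : (1 - t) * (a / (a + t) - 1) + t * ((a + 1) / (a + t) - 1) = 0.
  by field; lra.
have H3 : (1 - t) * (ln a - ln (a + t)) <= (1 - t) * (a / (a + t) - 1).
  by rewrite ler_wpM2l ?lnB_le//; lra.
have H4 : t * (ln (a + 1) - ln (a + t)) <= t * ((a + 1) / (a + t) - 1).
  by rewrite ler_wpM2l ?lnB_le//; lra.
lra.
Qed.

Lemma ln_bernoulli_ge (a t : R) : 0 < a -> 0 < a + t -> (t <= 0) || (1 <= t) ->
  ln (a + t) <= (1 - t) * ln a + t * ln (a + 1).
Proof.
move=> a0 at0; have a1 : 0 < a + 1 by lra.
case/orP => ht.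
- have H1 := lnB_le at0 a0.
  have H4 : - t * (ln (a + 1) - ln a) <= - t * ((a + 1) / a - 1).
    by rewrite ler_wpM2l ?lnB_le//; lra.
  have E : ((a + t) / a - 1) + - t * ((a + 1) / a - 1) = 0.
    by field; lra.
  lra.
- have H1 := lnB_le at0 a1.
  have H4 : (t - 1) * (ln a - ln (a + 1)) <= (t - 1) * (a / (a + 1) - 1).
    by rewrite ler_wpM2l ?lnB_le//; lra.
  have E : ((a + t) / (a + 1) - 1) + (t - 1) * (a / (a + 1) - 1) = 0.
    by field; lra.
  lra.
Qed.

Definition weight_cst c : R := expR (`|c - 1| * ln (1 + c)).

Lemma ln_weightS c k : 0 < c -> (1 <= k)%N ->
  ln (weight c k.+1) = ln (weight c k) + (ln (k%:R + 1) - ln (k%:R + c)).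
Proof.
move=> c0 k1; have k0 : 0 < k%:R :> R by rewrite ltr0n.
rewrite weightS// lnM ?posrE ?weight_gt0//; last by apply: divr_gt0; lra.
by rewrite ln_div ?posrE//; lra.
Qed.

Lemma ln_weight_le c k : 0 < c -> (1 <= k)%N ->
  ln (weight c k) <= (1 - c) * ln k%:R + `|c - 1| * ln (1 + c).
Proof.
move=> c0 k1; have lnc0 : 0 <= ln (1 + c) by apply: ln_ge0; lra.
have [c1|c1] := leP c 1.
  apply: (@le_trans _ _ ((1 - c) * ln k%:R)); last by rewrite lerDl mulr_ge0.
  elim: k k1 => // -[|k] IH _.
    by rewrite /weight ratio1 mulr1 ln1 mulr0.
  rewrite ln_weightS//; have {}IH := IH isT.
  have k0 : 0 < k.+1%:R :> R by rewrite ltr0n.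
  have := @ln_bernoulli_le k.+1%:R c k0.
  rewrite ltW//= c1 => /(_ isT); rewrite natr1 => H.
  by lra.
have -> : `|c - 1| = c - 1 by rewrite gtr0_norm//; lra.
have kp : 0 < k%:R :> R by rewrite ltr0n.
apply: (@le_trans _ _ ((1 - c) * ln (k%:R + c) + (c - 1) * ln (1 + c))); last first.
  rewrite lerD2r ler_wnM2l//; first by lra.
  by rewrite ler_ln ?posrE; lra.
elim: k k1 kp => // -[|k] IH _ kp.
  by rewrite /weight ratio1 mulr1 ln1; lra.
rewrite ln_weightS//; have {}IH := IH isT.
have k0 : 0 < k.+1%:R :> R by rewrite ltr0n.
have {}IH := IH k0.
have := @ln_bernoulli_ge (k.+1%:R + c) (1 - c).
have -> : k.+1%:R + c + (1 - c) = k.+1%:R + 1 by ring.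
have -> : k.+1%:R + c + 1 = k.+2%:R + c by rewrite -(natr1 k.+1); ring.
have h1 : (1 - c <= 0) || (1 <= 1 - c) by apply/orP; left; lra.
have h2 : 0 < k.+1%:R + c by lra.
have h3 : 0 < k.+1%:R + 1 :> R by lra.
by move=> /(_ h2 h3 h1); lra.
Qed.

Lemma ln_weight_ge c k : 0 < c -> (1 <= k)%N ->
  (1 - c) * ln k%:R - `|c - 1| * ln (1 + c) <= ln (weight c k).
Proof.
move=> c0 k1; have lnc0 : 0 <= ln (1 + c) by apply: ln_ge0; lra.
have kp : 0 < k%:R :> R by rewrite ltr0n.
have [c1|c1] := leP 1 c.
  apply: (@le_trans _ _ ((1 - c) * ln k%:R)); first by rewrite gerBl mulr_ge0.
  elim: k k1 kp => // -[|k] IH _ kp.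
    by rewrite /weight ratio1 mulr1 ln1 mulr0.
  rewrite ln_weightS//; have {}IH := IH isT.
  have k0 : 0 < k.+1%:R :> R by rewrite ltr0n.
  have {}IH := IH k0.
  have := @ln_bernoulli_ge k.+1%:R c k0.
  rewrite c1 orbT natr1.
  have h2 : 0 < k.+1%:R + c by lra.
  move=> /(_ h2 isT) H.
  by lra.
have -> : `|c - 1| = 1 - c by rewrite ltr0_norm//; lra.
apply: (@le_trans _ _ ((1 - c) * ln (k%:R + c) - (1 - c) * ln (1 + c))).
  rewrite lerD2r ler_wpM2l//; first by lra.
  by rewrite ler_ln ?posrE; lra.
elim: k k1 kp => // -[|k] IH _ kp.
  by rewrite /weight ratio1 mulr1 ln1; lra.
rewrite ln_weightS//; have {}IH := IH isT.
have k0 : 0 < k.+1%:R :> R by rewrite ltr0n.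
have {}IH := IH k0.
have h2 : 0 < k.+1%:R + c by lra.
have := @ln_bernoulli_le (k.+1%:R + c) (1 - c) h2.
have -> : k.+1%:R + c + (1 - c) = k.+1%:R + 1 by ring.
have -> : k.+1%:R + c + 1 = k.+2%:R + c by rewrite -(natr1 k.+1); ring.
have h1 : 0 <= 1 - c <= 1 by apply/andP; split; lra.
by move=> /(_ h1); lra.
Qed.

Lemma weight_le c k : 0 < c -> (1 <= k)%N ->
  weight c k <= weight_cst c * expR ((1 - c) * ln k%:R).
Proof.
move=> c0 k1; rewrite /weight_cst -expRD.
rewrite -[leLHS]lnK ?posrE ?weight_gt0// ler_expR addrC.
exact: ln_weight_le.
Qed.

Lemma weight_ge c k : 0 < c -> (1 <= k)%N ->
  expR ((1 - c) * ln k%:R) <= weight_cst c * weight c k.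
Proof.
move=> c0 k1; rewrite /weight_cst -[weight c k]lnK ?posrE ?weight_gt0// -expRD ler_expR.
by have := ln_weight_ge c0 k1; lra.
Qed.

Lemma ratio_cvg0 c : 0 < c -> ratio c @ \oo --> 0.
Proof.
move=> c0.
have H k : (1 <= k)%N -> 0 <= ratio c k <= weight_cst c * expR (- (c * ln k%:R)).
  move=> k1; have k0 : 0 < k%:R :> R by rewrite ltr0n.
  rewrite ltW ?ratio_gt0//=.
  have -> : ratio c k = expR (- ln k%:R) * weight c k.
    by rewrite /weight expRN lnK ?posrE// mulKf// gt_eqF.
  apply: (le_trans (ler_wpM2l (expR_ge0 _) (weight_le c0 k1))).
  by rewrite mulrCA -expRD ler_wpM2l ?expR_ge0// ler_expR; lra.
have lim : weight_cst c * expR (- (c * ln k%:R)) @[k --> \oo] --> 0.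
  rewrite -[X in _ --> X](mulr0 (weight_cst c)).
  apply: cvgMl_tmp; apply: (cvg_comp _ _ _ (@cvgr_expR R)).
  apply/cvgryPge => A; near=> k.
  rewrite mulrC -ler_pdivrMr// -[leLHS]expRK ler_ln ?posrE ?expR_gt0//.
    by near: k; exact: nbhs_infty_ger.
  rewrite ltr0n; near: k; exact: nbhs_infty_gt.
apply: (squeeze_cvgr _ (cvg_cst 0) lim); near=> k.
by apply: H; near: k; exact: nbhs_infty_gt.
Unshelve. all: by end_near. Qed.

Lemma nneseries_EFin (u : nat -> R) (l : R) :
  series u @ \oo --> l -> (\sum_(k <oo) (u k)%:E = l%:E)%E.
Proof.
move=> ul; apply/cvg_lim => //.
have -> : (fun N => \sum_(0 <= k < N) (u k)%:E)%E = EFin \o series u.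
  by apply/funext => N /=; rewrite sumEFin.
exact: cvg_comp ul _.
Qed.

Lemma weight_jump c j : 0 < c -> (1 <= j)%N ->
  (\sum_(k <oo) ((j < k)%:R * (weight c k / (k%:R * (k%:R - 1))))%:E =
  (ratio c j / c)%:E)%E.
Proof.
move=> c0 j1; apply: nneseries_EFin.
have H N : (j <= N)%N ->
    series (fun k => (j < k)%:R * (weight c k / (k%:R * (k%:R - 1)))) N.+1 =
    (ratio c j - ratio c N) / c.
  move=> jN; rewrite -(subnKC jN); elim: (N - j)%N => [|i IH].
    rewrite addn0 subrr mul0r /series/= big1_seq// => k.
    by rewrite mem_index_iota => /andP[_ /andP[_ kj]]; rewrite ltnNge -ltnS kj mul0r.
  rewrite addnS seriesSr IH.
  have -> : (j < (j + i).+1)%N by lia.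
  have ji : (1 <= j + i)%N by lia.
  rewrite mul1r /weight ratioS//.
  have ji0 : 0 < (j + i)%:R :> R by rewrite ltr0n.
  rewrite -natr1 addrK; move: (j + i)%:R (ratio _ _) ji0 => x y x0.
  by field; lra.
rewrite -(cvg_shiftS (series _)).
have : (ratio c j - ratio c N) / c @[N --> \oo] --> (ratio c j - 0) / c.
  by apply: cvgMr_tmp; apply: cvgB; [exact: cvg_cst|exact: ratio_cvg0].
rewrite subr0; apply: cvg_trans; apply: near_eq_cvg; near=> N.
by rewrite /= -H//; near: N; exact: nbhs_infty_ge.
Unshelve. all: by end_near. Qed.

(* [c ^- n] is the exponential moment at [1 - c] of a sum of [n] exponential
   variables, which the logarithm of the chain approximates. *)
Lemma law_weight n c : 0 < c ->
  (\sum_(k <oo) (law n k * weight c k)%:E = (c ^- n)%:E)%E.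
Proof.
move=> c0; elim: n => [|n IH].
  rewrite expr0 invr1; apply: nneseries_EFin; rewrite -(cvg_shiftn 2).
  apply: cvg_near_cst; near=> N => /=.
  rewrite /series/= addn2 big_nat_recl// big_nat_recl// big1 ?addr0 => [|i _].
    by rewrite /weight ratio1 !mul0r add0r !mulr1.
  by rewrite /= mul0r.
pose a j k : R := law n j * j%:R *
  ((j < k)%:R * (weight c k / (k%:R * (k%:R - 1)))).
have w0 j k : 0 <= (j < k)%:R * (weight c k / (k%:R * (k%:R - 1))).
  rewrite mulr_ge0// divr_ge0 ?weight_ge0//.
  by case: k => [|k]; rewrite ?mul0r// mulr_ge0// subr_ge0 ler1n.
have a0 j k : (0 <= (a j k)%:E)%E.
  by rewrite lee_fin /a mulr_ge0// mulr_ge0// law_ge0.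
transitivity (\sum_(k <oo) \sum_(j <oo) (a j k)%:E)%E.
  apply: eq_eseriesr => k _; apply/esym/nneseries_EFin.
  rewrite -(cvg_shiftn k); apply: cvg_near_cst; near=> N => /=.
  rewrite /series/= (@big_cat_nat _ _ _ k)//= ?leq_addl//.
  rewrite [X in _ + X]big1_seq ?addr0 => [|j]; last first.
    by rewrite mem_index_iota /a => /andP[_ /andP[kj _]]; rewrite ltnNge kj mul0r mulr0.
  rewrite big_mkord mulrAC mulr_suml; rewrite mulr_suml.
  apply: eq_bigr => j _; rewrite /a ltn_ord mul1r; ring.
rewrite nneseries_interchange//.
transitivity (\sum_(j <oo) ((c^-1)%:E * (law n j * weight c j)%:E))%E; last first.
  rewrite nneseriesZl => [|j _]; last by rewrite lee_fin mulr_ge0 ?law_ge0 ?weight_ge0.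
  by rewrite IH -EFinM exprS invfM.
apply: eq_eseriesr => -[|j] _.
  by rewrite law0r mul0r mule0 eseries0// => k _ _; rewrite /a law0r !mul0r.
under eq_eseriesr do rewrite /a EFinM.
rewrite nneseriesZl ?weight_jump// -?EFinM => [|k _]; last by rewrite lee_fin.
by congr EFin; rewrite /weight; field; rewrite gt_eqF.
Unshelve. all: by end_near. Qed.

Lemma law_sum n : (\sum_(k <oo) (law n k)%:E = 1)%E.
Proof.
have := @law_weight n 1 ltr01; rewrite expr1n invr1 => <-.
apply: eq_eseriesr => -[|k] _; first by rewrite law0r mul0r.
by rewrite weight1// mulr1.
Qed.

End law.

(** * Large deviations for the chain *)

Section rate.
Context {R : realType}.
Implicit Types x a : R.

(* The right-hand side needs no case distinction: it forces [-1 < x]. *)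
Lemma I_C_le x a : (I_C x <= a%:E)%E = (expR (x - a) <= 1 + x).
Proof.
rewrite /I_C; case: ifPn => [x1|].
  have x0 : 0 < 1 + x by lra.
  rewrite lee_fin -[in RHS](lnK x0) ler_expR addrC [x + 1]addrC.
  by apply/idP/idP; lra.
rewrite -leNgt leye_eq => x1; apply/esym/negbTE; rewrite -ltNge.
by apply: (@le_lt_trans _ _ 0); [lra|exact: expR_gt0].
Qed.

Lemma I_C_ge0 x : (0 <= I_C x)%E.
Proof.
rewrite /I_C; case: ifPn => // x1; rewrite lee_fin subr_ge0 addrC.
exact: le_ln1Dx.
Qed.

Lemma good_I_C : good_rate_function (@I_C R).
Proof.
have cont a : continuous (fun x => 1 + x - expR (x - a) : R).
  move=> x; apply: cvgB; first by apply: cvgD; [exact: cvg_cst|exact: cvg_id].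
  apply: continuous_comp; last exact: continuous_expR.
  by apply: cvgB; [exact: cvg_id|exact: cvg_cst].
have levelE a : [set x | (I_C x <= a%:E)%E] =
    (fun x => 1 + x - expR (x - a)) @^-1` [set y | 0 <= y].
  by apply/seteqP; split => x /=; rewrite I_C_le subr_ge0.
have closed_level a : closed [set x : R | (I_C x <= a%:E)%E].
  rewrite levelE; apply: closed_comp; last exact: closed_ge.
  by move=> x _; exact: cont.
split; first exact: I_C_ge0.
- apply/lower_semicontinuousP => a.
  have -> : [set x : R | (a%:E < I_C x)%E] = ~` [set x | (I_C x <= a%:E)%E].
    by apply/seteqP; split => x /=; rewrite ltNge => /negP.
  exact/closed_openC.
- move=> a a0.
  apply: (subclosed_compact (closed_level a) (@segment_compact _ (-1) (4 + 2 * a))).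
  move=> x /=; rewrite I_C_le in_itv /= => H.
  have x1 : 0 < 1 + x by apply: lt_le_trans H; exact: expR_gt0.
  apply/andP; split; first by lra.
  rewrite leNgt; apply/negP => xa.
  have := expR_ge1Dxn 1 (_ : 0 <= x - a); rewrite (_ : 2`!%:R = 2)// => H2.
  have {}H2 : 1 + (x - a) ^+ 2 / 2 <= expR (x - a) by apply: H2; lra.
  have : (x - a) ^+ 2 <= 2 * x by lra.
  by rewrite expr2; nra.
Qed.

End rate.

Section limits.
Context {R : realType}.
Implicit Types (u P : nat -> \bar R) (l : \bar R).

Lemma limn_esup_le u l N : (forall n, (N <= n)%N -> (u n <= l)%E) ->
  (limn_esup u <= l)%E.
Proof.
move=> H; rewrite /limn_esup /limf_esup; apply: ge_ereal_inf.
exists (ereal_sup (u @` [set k | (N <= k)%N])).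
  by exists [set k | (N <= k)%N] => //; exact: nbhs_infty_ge.
by apply: ge_ereal_sup => _ [n Nn <-]; exact: H.
Qed.

Lemma limn_einf_ge u l N : (forall n, (N <= n)%N -> (l <= u n)%E) ->
  (l <= limn_einf u)%E.
Proof.
move=> H; rewrite /limn_einf leeNr; apply: (@limn_esup_le _ _ N) => n Nn.
by rewrite leeN2; exact: H.
Qed.

Lemma limn_esup_lne P (b B : R) N : 0 < B ->
  (forall n, (N <= n)%N -> (0 <= P n <= (B * expR (- (n%:R * b)))%:E)%E) ->
  (limn_esup (fun n => (n%:R^-1)%:E * lne (P n)) <= (- b)%:E)%E.
Proof.
move=> B0 H; apply/lee_addgt0Pr => e e0.
pose M := (Num.truncn (`|ln B| / e)).+1.
apply: (@limn_esup_le _ _ (maxn N (maxn M 1))) => n; rewrite !geq_max.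
move=> /and3P[Nn Mn n1]; have /andP[P0 PB] := H _ Nn.
have n0 : 0 < n%:R :> R by rewrite ltr0n.
have BE : 0 < B * expR (- (n%:R * b)) by rewrite mulr_gt0// expR_gt0.
apply: (@le_trans _ _ ((n%:R^-1)%:E * lne (B * expR (- (n%:R * b)))%:E)%E).
  apply: lee_wpmul2l; first by rewrite lee_fin invr_ge0 ltW.
  by rewrite lee_lne// in_itv/= ?leey ?P0// andbT lee_fin ltW.
rewrite lne_EFin// lnM ?posrE ?expR_gt0// expRK -EFinM lee_fin.
rewrite mulrBr mulKf ?gt_eqF//; suff : n%:R^-1 * ln B <= e by lra.
rewrite mulrC ler_pdivrMr//.
apply: (le_trans (ler_norm _)); rewrite mulrC -ler_pdivrMr//.
by apply: ltW; apply: lt_le_trans (truncnS_gt _) _; rewrite ler_nat.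
Qed.

Lemma limn_einf_lne P (b B : R) N : 0 < B ->
  (forall n, (N <= n)%N -> ((B * expR (- (n%:R * b)))%:E <= P n)%E) ->
  ((- b)%:E <= limn_einf (fun n => (n%:R^-1)%:E * lne (P n)))%E.
Proof.
move=> B0 H; apply/lee_addgt0Pr => e e0; rewrite -leeBlDr//.
pose M := (Num.truncn (`|ln B| / e)).+1.
apply: (@limn_einf_ge _ _ (maxn N (maxn M 1))) => n; rewrite !geq_max.
move=> /and3P[Nn Mn n1]; have PB := H _ Nn.
have n0 : 0 < n%:R :> R by rewrite ltr0n.
have BE : 0 < B * expR (- (n%:R * b)) by rewrite mulr_gt0// expR_gt0.
apply: (@le_trans _ _ ((n%:R^-1)%:E * lne (B * expR (- (n%:R * b)))%:E)%E); last first.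
  apply: lee_wpmul2l; first by rewrite lee_fin invr_ge0 ltW.
  rewrite lee_lne// in_itv/= ?leey ?andbT ?lee_fin ?ltW//.
  by apply: lt_le_trans PB; rewrite lte_fin.
rewrite lne_EFin// lnM ?posrE ?expR_gt0// expRK -EFinM lee_fin.
rewrite mulrBr mulKf ?gt_eqF//; suff : n%:R^-1 * - ln B <= e by lra.
rewrite mulrC ler_pdivrMr//.
apply: (le_trans (ler_norm _)); rewrite normrN mulrC -ler_pdivrMr//.
by apply: ltW; apply: lt_le_trans (truncnS_gt _) _; rewrite ler_nat.
Qed.

End limits.

Section tails.
Context {R : realType}.
Implicit Types (n k : nat) (S : set nat).

Definition law_expectation n (w : nat -> R) : \bar R :=
  (\sum_(k <oo) (law n k * w k)%:E)%E.

Lemma law_expectation_le n w v : (forall k, (1 <= k)%N -> 0 <= w k <= v k) ->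
  (law_expectation n w <= law_expectation n v)%E.
Proof.
move=> H; apply: lee_nneseries => [[|k] _ _|[|k] _]; rewrite ?law0r ?mul0r// lee_fin.
  by rewrite mulr_ge0 ?law_ge0//; have /andP[] := H k.+1 isT.
by rewrite ler_wpM2l ?law_ge0//; have /andP[] := H k.+1 isT.
Qed.

Lemma law_expectationD n w v : (forall k, 0 <= w k) -> (forall k, 0 <= v k) ->
  law_expectation n (fun k => w k + v k) =
  (law_expectation n w + law_expectation n v)%E.
Proof.
move=> w0 v0; rewrite /law_expectation -nneseriesD.
- by apply: eq_eseriesr => k _; rewrite -EFinD mulrDr.
- by move=> k _ _; rewrite lee_fin mulr_ge0 ?law_ge0.
- by move=> k _ _; rewrite lee_fin mulr_ge0 ?law_ge0.
Qed.

Lemma law_expectationZ n b w : (forall k, 0 <= w k) ->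
  law_expectation n (fun k => b * w k) = (b%:E * law_expectation n w)%E.
Proof.
move=> w0; rewrite /law_expectation -nneseriesZl.
- by apply: eq_eseriesr => k _; rewrite -EFinM mulrCA.
- by move=> k _; rewrite lee_fin mulr_ge0 ?law_ge0.
Qed.

Definition mass n S : \bar R := law_expectation n \1_S.

Lemma mass_ge0 n S : (0 <= mass n S)%E.
Proof. by apply: nneseries_ge0 => k _ _; rewrite lee_fin mulr_ge0 ?law_ge0. Qed.

Lemma mass_eq0 n S : (forall k, (2 <= k)%N -> ~ S k) -> mass n.+1 S = 0%E.
Proof.
move=> S0; apply: eseries0 => k _ _.
have [k1|k2] := leqP k 1; last first.
  by rewrite indicE memNset ?mulr0//; exact: S0.
by case: k k1 => [|[|]]// _; rewrite ?law0r ?lawS1 mul0r.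
Qed.

Lemma mass_le n S S' : S `<=` S' -> (mass n S <= mass n S')%E.
Proof.
move=> SS; apply: law_expectation_le => k _; rewrite !indicE ler0n/=.
have [|//] := boolP (k \in S); rewrite inE => /SS Sk.
by rewrite mem_set.
Qed.

Lemma massU n S S' : (mass n (S `|` S') <= mass n S + mass n S')%E.
Proof.
rewrite -law_expectationD//; apply: law_expectation_le => k _.
rewrite !indicE ler0n/= in_setU.
by case: (k \in S); case: (k \in S') => /=; lra.
Qed.

Lemma expR_weight c (r : R) k : 0 < c -> (1 <= k)%N ->
  r <= (1 - c) * ln k%:R -> 1 <= weight_cst c * expR (- r) * weight c k.
Proof.
move=> c0 k1 H; rewrite mulrAC.
apply: le_trans (ler_wpM2r (expR_ge0 (- r)) (weight_ge c0 k1)).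
by rewrite -expRD -[leLHS]expR0 ler_expR; lra.
Qed.

Lemma weight_cst_gt0 (c : R) : 0 < weight_cst c.
Proof. exact: expR_gt0. Qed.

(* Exponential Markov inequality with the optimal [c = a^-1]: the condition on
   [S] says that [ln k / n] lies beyond [a], seen from the mean 1. *)
Lemma law_chernoff n S (a : R) : 0 < a ->
  (forall k, (1 <= k)%N -> S k -> 0 <= (1 - a^-1) * (ln k%:R - n%:R * a)) ->
  (mass n S <= (weight_cst a^-1 * expR (- (n%:R * (a - 1 - ln a))))%:E)%E.
Proof.
move=> a0 HS; have c0 : 0 < a^-1 by rewrite invr_gt0.
set c := a^-1 in c0 HS *.
pose r := (1 - c) * (n%:R * a).
apply: (@le_trans _ _
    (law_expectation n (fun k => weight_cst c * expR (- r) * weight c k))).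
  apply: law_expectation_le => k k1; rewrite indicE ler0n/=.
  have [|_] := boolP (k \in S); last first.
    by rewrite mulr_ge0 ?weight_ge0// mulr_ge0 ?expR_ge0// ltW ?weight_cst_gt0.
  rewrite inE => Sk; apply: expR_weight => //.
  by have := HS _ k1 Sk; rewrite mulrBr -/r; lra.
rewrite law_expectationZ => [|k]; last exact: weight_ge0.
rewrite [law_expectation _ _]law_weight// -EFinM lee_fin -mulrA.
rewrite ler_wpM2l ?(ltW (weight_cst_gt0 _))//.
rewrite /c exprVn invrK -[a in a ^+ n]lnK ?posrE// -expRM_natl -expRD ler_expR.
rewrite /r mulrBl mul1r mulrCA mulVf ?gt_eqF//; lra.
Qed.

Lemma expR_decay (K s e : R) : 0 < s -> 0 < e ->
  \forall n \near \oo, K * expR (- (n%:R * s)) <= e.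
Proof.
move=> s0 e0; near=> n.
have [K0|K0] := leP K 0.
  by apply: (le_trans _ (ltW e0)); rewrite mulr_le0_ge0// expR_ge0.
rewrite -ler_pdivlMl// -[leRHS]lnK ?posrE ?mulr_gt0 ?invr_gt0// ler_expR.
rewrite lerNl -ler_pdivrMr//.
by near: n; exact: nbhs_infty_ger.
Unshelve. all: by end_near. Qed.

Definition log_window n (a d : R) : set nat :=
  [set k | (1 <= k)%N /\ `|ln k%:R - n%:R * a| < n%:R * d].

(* Change of measure: under the tilted law [c ^+ n * law n k * weight c k] with
   [c = a^-1], [ln k / n] concentrates at [a]. *)
Lemma mass_lower (a d : R) : 0 < a -> 0 < d ->
  exists B, 0 < B /\ exists N, forall n, (N <= n)%N ->
  ((B * expR (- (n%:R * (a - 1 - ln a + `|1 - a^-1| * d))))%:E <=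
    mass n (log_window n a d))%E.
Proof.
move=> a0 d0; have c0 : 0 < a^-1 by rewrite invr_gt0.
set c := a^-1 in c0 *.
pose s := c * d; have s0 : 0 < s by rewrite mulr_gt0.
pose t := s / (2 * (1 + s)).
have t0 : 0 < t by rewrite divr_gt0//; lra.
have tE : t * (2 * (1 + s)) = s by rewrite /t mulfVK// gt_eqF//; lra.
have t1 : t < 1 by nra.
pose c1 := c * (1 - t); pose c2 := c * (1 + t).
have c10 : 0 < c1 by rewrite mulr_gt0//; lra.
have c20 : 0 < c2 by rewrite mulr_gt0//; lra.
pose C := weight_cst c.
pose h1 := (1 + s) * t + ln (1 - t).
pose h2 := ln (1 + t) - (1 - s) * t.
have h10 : 0 < h1.
  have h : 0 < 1 - t by lra.
  have := lnB_le ltr01 h; rewrite ln1 div1r /h1.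
  have : (1 - t)^-1 - 1 < (1 + s) * t.
    have -> : (1 - t)^-1 - 1 = t / (1 - t) by field; lra.
    by rewrite ltr_pdivrMr; [nra|lra].
  lra.
have h20 : 0 < h2.
  have h : 0 < 1 + t by lra.
  have := lnB_le ltr01 h; rewrite ln1 div1r /h2.
  have : (1 - s) * t < 1 - (1 + t)^-1.
    have -> : 1 - (1 + t)^-1 = t / (1 + t) by field; lra.
    rewrite ltr_pdivlMr; last by lra.
    by nra.
  lra.
exists (2 * C)^-1; split; first by rewrite invr_gt0 mulr_gt0// weight_cst_gt0.
have e0 : 0 < 4^-1 :> R by rewrite invr_gt0.
have [N1 _ HN1] := expR_decay (C * weight_cst c1) h10 e0.
have [N2 _ HN2] := expR_decay (C * weight_cst c2) h20 e0.
exists (maxn N1 N2) => n; rewrite geq_max => /andP[/HN1/= H1 /HN2/= H2].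
set W := log_window n a d.
have [M ME] : exists x,
  x = C * expR ((1 - c) * (n%:R * a) + `|1 - c| * (n%:R * d)) by eexists.
have [B1 B1E] : exists x,
  x = C * weight_cst c1 * expR (- (n%:R * (a + d) * (c - c1))) by eexists.
have [B2 B2E] : exists x,
  x = C * weight_cst c2 * expR (n%:R * (a - d) * (c2 - c)) by eexists.
have Cp : 0 < C := weight_cst_gt0 _.
have M0 : 0 <= M by rewrite ME mulr_ge0 ?expR_ge0// ltW.
have B10 : 0 <= B1 by rewrite B1E !mulr_ge0 ?expR_ge0// ltW ?weight_cst_gt0.
have B20 : 0 <= B2 by rewrite B2E !mulr_ge0 ?expR_ge0// ltW ?weight_cst_gt0.
have key : ((c ^- n)%:E <= M%:E * mass n W + (B1 * c1 ^- n + B2 * c2 ^- n)%:E)%E.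
  rewrite -law_weight// EFinD !EFinM -!law_weight//.
  rewrite -!law_expectationZ//; [|by move=> k; exact: weight_ge0..].
  rewrite -!law_expectationD.
  - apply: law_expectation_le => k k1; rewrite weight_ge0//=.
    have wc := weight_le c0 k1.
    have p1 : 0 <= B1 * weight c1 k by rewrite mulr_ge0 ?weight_ge0.
    have p2 : 0 <= B2 * weight c2 k by rewrite mulr_ge0 ?weight_ge0.
    have [Wk|] := pselect (W k).
      rewrite indicE mem_set// mulr1.
      suff : weight c k <= M by lra.
      apply: (le_trans wc); rewrite ME ler_wpM2l//; first exact: ltW.
      rewrite ler_expR -lerBlDl -mulrBr; case: Wk => _ /ltW Wk.
      by rewrite (le_trans (ler_norm _))// normrM ler_wpM2l.
    move=> nWk; rewrite indicE memNset// mulr0 add0r.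
    have : n%:R * d <= `|ln k%:R - n%:R * a|.
      by rewrite leNgt; apply/negP => Wk; apply: nWk.
    rewrite ler_normr => /orP[lnk|lnk].
    + suff : weight c k <= B1 * weight c1 k by lra.
      apply: (le_trans wc); rewrite B1E -!mulrA ler_wpM2l//; first exact: ltW.
      rewrite mulrCA; apply: le_trans (ler_wpM2l (expR_ge0 _) (weight_ge c10 k1)).
      rewrite -expRD ler_expR.
      have : 0 <= (c - c1) * (ln k%:R - n%:R * (a + d)).
        by apply: mulr_ge0; rewrite /c1; nra.
      lra.
    + suff : weight c k <= B2 * weight c2 k by lra.
      apply: (le_trans wc); rewrite B2E -!mulrA ler_wpM2l//; first exact: ltW.
      rewrite mulrCA; apply: le_trans (ler_wpM2l (expR_ge0 _) (weight_ge c20 k1)).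
      rewrite -expRD ler_expR.
      have : 0 <= (c2 - c) * (n%:R * (a - d) - ln k%:R).
        by apply: mulr_ge0; rewrite /c2; nra.
      lra.
  - by move=> k; rewrite mulr_ge0.
  - by move=> k; rewrite addr_ge0// mulr_ge0 ?weight_ge0.
  - by move=> k; rewrite mulr_ge0 ?weight_ge0.
  - by move=> k; rewrite mulr_ge0 ?weight_ge0.
have ac : a * c = 1 by rewrite mulfV ?gt_eqF.
have cn0 : 0 < c ^- n by rewrite invr_gt0 exprn_gt0.
have tilt c' u : 0 < u -> c' = c * u ->
    c' ^- n = c ^- n * expR (- (n%:R * ln u)).
  by move=> u0 ->; rewrite exprMn invfM expRN expRM_natl lnK.
have b1 : B1 * c1 ^- n <= c ^- n / 4.
  rewrite (tilt c1 (1 - t))//; last by lra.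
  rewrite mulrCA ler_pM2l//; apply: le_trans H1.
  rewrite B1E -!mulrA -expRD le_eqVlt; apply/orP; left; apply/eqP.
  congr (_ * (_ * expR _)).
  have -> : n%:R * ((a + d) * (c - c1)) = n%:R * ((a * c + d * c) * t).
    by rewrite /c1; ring.
  by rewrite ac /h1 /s; ring.
have b2 : B2 * c2 ^- n <= c ^- n / 4.
  rewrite (tilt c2 (1 + t))//; last by lra.
  rewrite mulrCA ler_pM2l//; apply: le_trans H2.
  rewrite B2E -!mulrA -expRD le_eqVlt; apply/orP; left; apply/eqP.
  congr (_ * (_ * expR _)).
  have -> : n%:R * ((a - d) * (c2 - c)) = n%:R * ((a * c - d * c) * t).
    by rewrite /c2; ring.
  by rewrite ac /h2 /s; ring.
have -> : (2 * C)^-1 * expR (- (n%:R * (a - 1 - ln a + `|1 - c| * d))) =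
    c ^- n / 2 / M.
  have -> : M^-1 = C^-1 * expR (- ((1 - c) * (n%:R * a) +
      `|1 - c| * (n%:R * d))) by rewrite ME invfM expRN.
  rewrite (invfM 2 C).
  have -> : c ^- n = expR (n%:R * ln a).
    by rewrite expRM_natl lnK// /c exprVn invrK.
  set r := - ((1 - c) * _ + _); have -> : - (n%:R * (a - 1 - ln a + `|1 - c| * d)) =
      n%:R * ln a + r.
    rewrite /r; have -> : (1 - c) * (n%:R * a) = n%:R * (a - a * c) by ring.
    by rewrite ac; ring.
  by rewrite expRD; ring.
have Mp : 0 < M by rewrite ME mulr_gt0 ?expR_gt0.
case: (mass n W) (mass_ge0 n W) key => [r|_ _|//]; last by rewrite leey.
by move=> _; rewrite -EFinM -EFinD !lee_fin ler_pdivrMr// => key; lra.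
Qed.
End tails.

Section ldp.
Context {R : realType}.
Implicit Types (n k : nat) (Gamma : set R).

Lemma closure_inf (A : set R) : has_inf A -> closure A (inf A).
Proof.
move=> iA U /nbhs_ballP[e /= e0 eU]; have [x Ax xe] := inf_adherent e0 iA.
exists x; split => //; apply: eU; rewrite /ball /= ltr_distlC.
have : inf A <= x by apply: ge_inf => //; case: iA.
lra.
Qed.

Lemma ln_nat_gt0 k : (2 <= k)%N -> 0 < ln k%:R :> R.
Proof. by move=> k2; apply: ln_gt0; rewrite ltr1n. Qed.

Definition centered n k : R := (ln k%:R - n%:R) / n%:R.

Lemma centeredE n k : (1 <= n)%N -> ln k%:R = n%:R * (1 + centered n k).
Proof.
by move=> n1; rewrite /centered mulrDr mulrCA mulfV ?pnatr_eq0 -?lt0n//; lra.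
Qed.

Lemma mass_upper_half Gamma (b : R) : (b%:E < ereal_inf (@I_C R @` closure Gamma))%E ->
  exists2 B, 0 < B & forall n, (1 <= n)%N ->
    (mass n [set k | Gamma (centered n k) /\ 0 <= centered n k]%R <=
     (B * expR (- (n%:R * b)))%:E)%E.
Proof.
move=> bJ; pose F := closure Gamma `&` [set x | 0 <= x].
have [F0|F0] := pselect (F !=set0); last first.
  exists 1 => // -[//|n] _; rewrite mass_eq0 ?lee_fin ?mulr_ge0 ?expR_ge0//.
  move=> k _ [Gk k0]; apply: F0; exists (centered n.+1 k); split => //.
  exact: subset_closure.
have iF : has_inf F by split => //; exists 0 => x [].
have [Gx x0] : F (inf F).
  rewrite {1}(_ : F = closure F); first exact: closure_inf.
  apply/closure_id; apply: closedI; [exact: closed_closure|exact: closed_ge].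
set x := inf F in Gx x0; have {}x0 : 0 <= x := x0.
have bI : b < x - ln (x + 1).
  rewrite -lte_fin; apply: (lt_le_trans bJ); apply: ereal_inf_lbound.
  by exists x => //; rewrite /I_C ifT//; lra.
exists (weight_cst (1 + x)^-1); first exact: weight_cst_gt0.
move=> n n1; have a0 : 0 < 1 + x by lra.
apply: le_trans (law_chernoff (n := n) a0 _) _.
- move=> k k1 /= [Gk k0]; rewrite (centeredE k n1) -mulrBr mulr_ge0//.
    by rewrite subr_ge0 invf_le1; lra.
  rewrite mulr_ge0// opprD addrACA subrr add0r subr_ge0.
  by apply: ge_inf; [case: iF|split => //; exact: subset_closure].
- rewrite lee_fin ler_wpM2l ?(ltW (weight_cst_gt0 _))// ler_expR lerN2 ler_wpM2l//.
  by rewrite [1 + x]addrC; lra.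
Qed.

Lemma mass_lower_half Gamma (b : R) : (b%:E < ereal_inf (@I_C R @` closure Gamma))%E ->
  exists2 B, 0 < B & forall n, (1 <= n)%N ->
    (mass n [set k | Gamma (centered n k) /\ centered n k <= 0]%R <=
     (B * expR (- (n%:R * b)))%:E)%E.
Proof.
move=> bJ; pose F := closure Gamma `&` [set x | x <= 0].
have [F0|F0] := pselect (F !=set0); last first.
  exists 1 => // -[//|n] _; rewrite mass_eq0 ?lee_fin ?mulr_ge0 ?expR_ge0//.
  move=> k _ [Gk k0]; apply: F0; exists (centered n.+1 k); split => //.
  exact: subset_closure.
have uF : has_ubound F by exists 0 => x [].
have [Gx x0] : F (sup F).
  rewrite {1}(_ : F = closure F); first exact: closure_sup.
  apply/closure_id; apply: closedI; [exact: closed_closure|exact: closed_le].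
have FG n k : Gamma (centered n k) -> centered n k <= 0 -> centered n k <= sup F.
  by move=> Gk k0; apply: ub_le_sup => //; split => //; exact: subset_closure.
set x := sup F in Gx x0 FG; have {}x0 : x <= 0 := x0.
have [x1|x1] := leP x (-1).
  exists 1 => // -[//|n] _; rewrite mass_eq0 ?lee_fin ?mulr_ge0 ?expR_ge0//.
  move=> k k2 [Gk k0]; have := FG _ _ Gk k0; apply/negP; rewrite -ltNge.
  apply: (le_lt_trans x1); have := ln_nat_gt0 k2.
  rewrite (@centeredE n.+1 k)// pmulr_rgt0 ?ltr0n//; lra.
have bI : b < x - ln (x + 1).
  rewrite -lte_fin; apply: (lt_le_trans bJ); apply: ereal_inf_lbound.
  by exists x => //; rewrite /I_C x1.
exists (weight_cst (1 + x)^-1); first exact: weight_cst_gt0.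
move=> n n1; have a0 : 0 < 1 + x by lra.
apply: le_trans (law_chernoff (n := n) a0 _) _.
- move=> k k1 /= [Gk k0]; rewrite (centeredE k n1) -mulrBr mulr_le0//.
    by rewrite subr_le0 invf_ge1; lra.
  rewrite mulr_ge0_le0// opprD addrACA subrr add0r subr_le0.
  exact: FG.
- rewrite lee_fin ler_wpM2l ?(ltW (weight_cst_gt0 _))// ler_expR lerN2 ler_wpM2l//.
  by rewrite [1 + x]addrC; lra.
Qed.

Lemma mass_ldp_upper Gamma :
  (limn_esup (fun n => (n%:R^-1)%:E *
     lne (mass n [set k | Gamma (centered n k)]))
   <= - ereal_inf (@I_C R @` closure Gamma))%E.
Proof.
set J := ereal_inf _; set u := limn_esup _.
have H b : (b%:E < J)%E -> (u <= (- b)%:E)%E.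
  move=> bJ; have [B1 B10 HB1] := mass_upper_half bJ.
  have [B2 B20 HB2] := mass_lower_half bJ.
  apply: (@limn_esup_lne _ _ b (B1 + B2) 1); first exact: addr_gt0.
  move=> n n1; rewrite mass_ge0/= mulrDl EFinD.
  apply: le_trans (leeD (HB1 n n1) (HB2 n n1)); apply: le_trans (massU _ _ _).
  by apply: mass_le => k /= Gk; case: (leP 0 (centered n k)) => [|/ltW] ?; [left|right].
case EJ : J => [r| |].
- apply/lee_addgt0Pr => e e0; rewrite -EFinN -EFinD.
  have -> : - r + e = - (r - e) by ring.
  by apply: H; rewrite EJ lte_fin; lra.
- suff : u = -oo%E by move=> ->.
  have {}H b : (u <= b%:E)%E by rewrite -[b]opprK; apply: H; rewrite EJ ltry.
  case: u H => [r H|H|//]; last by have := H 0.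
  by have := H (r - 1); rewrite lee_fin lerBrDr gerDl ler10.
- have : (0 <= J)%E by apply: le_ereal_inf_tmp => _ [x _ <-]; exact: I_C_ge0.
  by rewrite EJ.
Qed.

Lemma mass_ldp_lower Gamma :
  (- ereal_inf (@I_C R @` Gamma°) <=
   limn_einf (fun n => (n%:R^-1)%:E *
     lne (mass n [set k | Gamma (centered n k)])))%E.
Proof.
rewrite leeNl; apply: le_ereal_inf_tmp => _ [x Gx <-]; rewrite leeNl.
rewrite /I_C; case: ifPn => [x1|_]; last by rewrite leNye.
apply/lee_addgt0Pr => e e0; rewrite -leeBlDr//.
have [d /= d0 dG] : exists2 d, 0 < d & ball x d `<=` Gamma by exact/nbhs_ballP.
have a0 : 0 < 1 + x by lra.
pose m := `|1 - (1 + x)^-1| + 1; have m0 : 0 < m by rewrite ltr_wpDl.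
pose d' := Num.min d (e / m).
have d'0 : 0 < d' by rewrite lt_min d0 divr_gt0.
have [B [B0 [N HN]]] := mass_lower a0 d'0.
pose b := x - ln (x + 1) + e.
have -> : ((- (x - ln (x + 1)))%:E - e%:E = (- b)%:E)%E.
  by rewrite -EFinB; congr EFin; rewrite /b; ring.
apply: (@limn_einf_lne _ _ b B (maxn N 1)) => // n; rewrite geq_max => /andP[Nn n1].
apply: (@le_trans _ _ (mass n (log_window n (1 + x) d'))).
  apply: le_trans (HN n Nn); rewrite lee_fin ler_wpM2l ?(ltW B0)// ler_expR lerN2.
  rewrite ler_wpM2l// /b [1 + x]addrC.
  have : `|1 - (x + 1)^-1| * d' <= e.
    apply: (@le_trans _ _ (m * d')).
      by rewrite ler_wpM2r ?(ltW d'0)// /m [1 + x]addrC lerDl.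
    by rewrite mulrC -ler_pdivlMr// ge_min lexx orbT.
  lra.
have n0 : 0 < n%:R :> R by rewrite ltr0n.
apply: mass_le => k /= [k1 Wk]; apply: dG.
rewrite /ball /= distrC; move: Wk; rewrite (centeredE k n1) -mulrBr normrM.
rewrite gtr0_norm// ltr_pM2l// opprD addrACA subrr add0r => /lt_le_trans; apply.
by rewrite ge_min lexx.
Qed.

End ldp.

Section transfer.
Context {d : measure_display} {T : measurableType d} {R : realType}.
Variables (mu : {measure set T -> \bar R}) (D : set T) (L : nat -> T -> nat).
Hypotheses (mD : measurable D) (muD : mu D = 1%E).
Hypothesis mL : forall n k, (1 <= n)%N -> (1 <= k)%N ->
  measurable (D `&` [set x | L n x = k]).
Hypothesis muL : forall n k, (1 <= n)%N -> (1 <= k)%N ->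
  mu (D `&` [set x | L n x = k]) = (law n k)%:E.

Let mLT n k : (1 <= n)%N -> measurable (D `&` [set x | L n x = k]).
Proof.
move=> n1; case: k => [|k]; last exact: mL.
rewrite (_ : _ `&` _ =
    D `\` \bigcup_(k in [set k | (1 <= k)%N]) (D `&` [set x | L n x = k])).
  by apply: measurableD => //; apply: bigcup_measurable => k k1; exact: mL.
apply/seteqP; split => x /= [Dx].
  by move=> L0; split => // -[k /= k1 [_ Lk]]; rewrite -Lk L0 in k1.
move=> H; split => //; apply/eqP; rewrite -leqn0 leqNgt; apply/negP => k1.
by apply: H; exists (L n x).
Qed.

Let pieceE n (S : set nat) : (1 <= n)%N ->
  D `&` [set x | S (L n x)] = \bigcup_(k in S) (D `&` [set x | L n x = k]).
Proof.
move=> n1; apply/seteqP; split => x /=.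
  by move=> [Dx Sx]; exists (L n x).
by move=> [k Sk [Dx ->]].
Qed.

Let mpiece n (S : set nat) : (1 <= n)%N -> measurable (D `&` [set x | S (L n x)]).
Proof. by move=> n1; rewrite pieceE//; apply: bigcup_measurable => k _; exact: mLT. Qed.

Let mu_series n (S : set nat) : (1 <= n)%N -> mu (D `&` [set x | S (L n x)]) =
  (\sum_(k <oo) mu (D `&` [set x | L n x = k]) * (\1_S k)%:E)%E.
Proof.
move=> n1; rewrite pieceE// measure_bigcup//.
- rewrite eseries_mkcond; apply: eq_eseriesr => k _; rewrite indicE.
  by case: ifP => kS; rewrite ?mule1 ?mule0.
- by move=> k _; exact: mLT.
- by move=> i j _ _ [x [[_ /= Li] [_ /= Lj]]]; rewrite -Li -Lj.
Qed.

Let muL0 n : (1 <= n)%N -> mu (D `&` [set x | L n x = 0%N]) = 0%E.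
Proof.
move=> n1; have := mu_series setT n1.
rewrite (_ : _ `&` _ = D) ?muD; last by apply/seteqP; split => x // [].
rewrite (eq_eseriesr (g := fun k => mu (D `&` [set x | L n x = k]))); last first.
  by move=> k _; rewrite indicE in_setT mule1.
rewrite nneseries_recl// => H.
have := @law_sum R n; rewrite nneseries_recl//; last first.
  by move=> k _; rewrite lee_fin law_ge0.
rewrite law0r add0e => E.
have E' : (\sum_(1 <= k <oo) mu (D `&` [set x | L n x = k]) = 1)%E.
  rewrite -[RHS]E -[LHS]nneseries_addn//.
  rewrite -[RHS]nneseries_addn => [|k]; last by rewrite lee_fin law_ge0.
  by apply: eq_eseriesr => k _; rewrite muL// addn1.
move: H; rewrite E'; case: (mu _) => [r| |]// [] r1.
by congr EFin; lra.
Qed.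

Lemma mass_transfer n (S : set nat) : (1 <= n)%N ->
  mu (D `&` [set x | S (L n x)]) = mass n S.
Proof.
move=> n1; rewrite mu_series//; apply: eq_eseriesr => -[|k] _.
  by rewrite muL0// mul0e law0r mul0r.
by rewrite muL// EFinM.
Qed.

Lemma ldp_of_law :
  satisfies_LDP mu D (fun n x => (ln (L n x)%:R - n%:R) / n%:R) (@I_C R).
Proof.
split; first exact: good_I_C.
- move=> n n1 _ B mB; exact: (mpiece [set k | B (centered n k)] n1).
- move=> Gamma mGamma.
  set u := fun n => (_ * lne (mu _))%E.
  have -> : u = fun n => ((n%:R^-1)%:E *
      lne (mass n [set k | Gamma (centered n k)]))%E.
    apply/funext => -[|n]; rewrite /u; first by rewrite invr0 !mul0e.
    by rewrite -mass_transfer.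
  by split; [exact: mass_ldp_lower|exact: limn_einf_sup|exact: mass_ldp_upper].
Qed.

End transfer.

(** * Digits of the modified Engel series *)

Section engel_measure.
Context {R : realType}.
Implicit Types (x y : R) (n k j : nat).

Definition engel_digit y : nat := (Num.truncn y^-1).+1.

Definition engel_rem y : R :=
  ((engel_digit y)%:R - 1) * (y - (engel_digit y)%:R^-1).

Definition remainder x n : R := iter n engel_rem x.

Definition digit x n : nat :=
  if n is m.+1 then engel_digit (remainder x m) else 1%N.

Lemma engel_digitP y : 0 < y <= 1 ->
  [/\ (2 <= engel_digit y)%N, (engel_digit y)%:R^-1 < y &
      y <= ((engel_digit y)%:R - 1)^-1].
Proof.
move=> /andP[y0 y1]; have yV : 1 <= y^-1 by rewrite invf_ge1.
have /andP[t1 t2] : (Num.truncn y^-1)%:R <= y^-1 < (Num.truncn y^-1).+1%:R.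
  by apply: truncn_itv; lra.
have t0 : (0 < Num.truncn y^-1)%N by rewrite truncn_gt0.
rewrite /engel_digit; split=> //; first by rewrite invf_plt ?posrE ?ltr0n.
by rewrite -natr1 addrK -[leLHS]invrK lef_pV2 ?posrE ?invr_gt0 ?ltr0n.
Qed.

Lemma engel_digit_eq y k : (2 <= k)%N -> k%:R^-1 < y -> y <= (k%:R - 1)^-1 ->
  engel_digit y = k.
Proof.
case: k => // k k2 ky yk; have k0 : 0 < k%:R :> R by rewrite ltr0n.
have y0 : 0 < y by apply: lt_trans ky; rewrite invr_gt0.
congr S; apply: truncn_def; apply/andP; split.
  by rewrite -[leLHS]invrK lef_pV2 ?posrE ?invr_gt0//; move: yk; rewrite -natr1 addrK.
by rewrite invf_plt ?posrE.
Qed.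

Lemma remainder_bounds x n : 0 < x <= 1 ->
  (1 <= digit x n)%N /\ 0 < remainder x n <= (digit x n)%:R^-1.
Proof.
move=> x01; elim: n => [|n [d1 /andP[r0 rd]]]; first by rewrite /= invr1.
set r := remainder x n in r0 rd.
have r1 : 0 < r <= 1.
  by rewrite r0 (le_trans rd)// invf_le1 ?ler1n// ltr0n.
have [e2 er re] := engel_digitP r1.
rewrite /= -/r /engel_rem; split => //.
have e0 : 1 < (engel_digit r)%:R :> R by rewrite ltr1n.
apply/andP; split; first by rewrite mulr_gt0//; lra.
rewrite -ler_pdivlMl; last by lra.
move: (engel_digit r)%:R e0 re er => e e0 re er.
apply: (le_trans (lerB re (lexx _))).
by rewrite le_eqVlt; apply/orP; left; apply/eqP; field; lra.
Qed.

Lemma digit_lt x n : 0 < x <= 1 -> (digit x n < digit x n.+1)%N.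
Proof.
move=> x01; have [d1 /andP[r0 rd]] := remainder_bounds n x01.
have r1 : 0 < remainder x n <= 1.
  by rewrite r0 (le_trans rd)// invf_le1 ?ler1n// ltr0n.
have [e2 er re] := engel_digitP r1.
rewrite -(@ltr_nat R) /= -ltf_pV2 ?posrE ?ltr0n//.
exact: lt_le_trans er rd.
Qed.

Definition cylinder n k (a b : R) : set R :=
  [set x | [/\ 0 < x <= 1, digit x n = k & a < remainder x n <= b]].

(* On [{d_n = k}] the remainder is uniformly distributed on [(0, 1/k]]. *)
Lemma lebesgue_cylinder n k (a b : R) : 0 <= a -> a <= b -> b * k%:R <= 1 ->
  measurable (cylinder n k a b) /\
  lebesgue_measure (cylinder n k a b) = (law n k * k%:R * (b - a))%:E.
Proof.
elim: n k a b => [|n IH] k a b a0 ab bk.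
  have [kE|k1] := eqVneq k 1%N; last first.
    rewrite (_ : cylinder _ _ _ _ = set0); last first.
      by apply/seteqP; split => x //= [_ /= k1' _]; rewrite -k1' in k1.
    by rewrite measure0 /= (negbTE k1) !mul0r.
  subst k; rewrite mulr1 in bk.
  rewrite (_ : cylinder _ _ _ _ = `]a, b]%classic); last first.
    apply/seteqP; split => x /=; rewrite in_itv/=; first by case.
    by move=> axb; split => //; move/andP: axb => [ax xb]; apply/andP; split; lra.
  split; first exact: measurable_itv.
  rewrite lebesgue_measure_itv /= lte_fin !mul1r; case: ltP => [|ba].
    by rewrite EFinB.
  by have -> : b - a = 0 by lra.
have [k1|k2] := leqP k 1.
  rewrite (_ : cylinder _ _ _ _ = set0); last first.
    apply/seteqP; split => x //= [x01 dk _]; have := digit_lt n x01.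
    have [d1 _] := remainder_bounds n x01.
    by rewrite dk ltnNge (leq_trans k1 d1).
  rewrite measure0; case: k k1 bk => [|[|]]// _ _; rewrite ?mulr0 ?lawS1 ?mul0r//.
have k0 : 1 < k%:R :> R by rewrite ltr1n.
pose h (u : R) := k%:R^-1 + u / (k%:R - 1).
have hb : h b <= (k%:R - 1)^-1.
  have -> : (k%:R - 1)^-1 = h k%:R^-1 by rewrite /h; field; lra.
  rewrite lerD2l ler_wpM2r ?invr_ge0//; first by lra.
  by rewrite -[leRHS]mul1r ler_pdivlMr//; lra.
have hab : h a <= h b by rewrite lerD2l ler_wpM2r// invr_ge0; lra.
have ha : k%:R^-1 <= h a by rewrite lerDl divr_ge0//; lra.
have kV : 0 < k%:R^-1 :> R by rewrite invr_gt0; lra.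
have hE r : (h a < r <= h b) = (a < (k%:R - 1) * (r - k%:R^-1) <= b).
  have K0 : 0 < k%:R - 1 :> R by lra.
  by rewrite /h -ltrBrDl -lerBlDl ltr_pdivrMr// ler_pdivlMr// mulrC.
have E : cylinder n.+1 k a b = \big[setU/set0]_(j < k) cylinder n j (h a) (h b).
  rewrite -(bigcup_mkord k (fun j => cylinder n j (h a) (h b))).
  apply/seteqP; split => x.
    move=> [x01 dk rab]; exists (digit x n) => /=; first by rewrite -dk digit_lt.
    by split => //; rewrite hE; move: dk rab; rewrite /= /engel_rem => ->.
  move=> [j /= jk [x01 dj rab]].
  have /andP[ar rb] := rab.
  have dk : engel_digit (remainder x n) = k.
    by apply: engel_digit_eq => //; [exact: le_lt_trans ha ar|exact: le_trans rb hb].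
  by split => //; rewrite /= /engel_rem dk -hE.
have Ij (j : 'I_k) := IH j (h a) (h b) (le_trans (ltW kV) ha) hab.
have hj (j : 'I_k) : h b * (j : nat)%:R <= 1.
  rewrite -[leRHS](@mulVf _ (k%:R - 1)); last by lra.
  apply: ler_pM => //; first by lra.
  by rewrite lerBrDr natr1 ler_nat.
rewrite E; split.
  by apply: bigsetU_measurable => j _; have [] := Ij j (hj j).
transitivity (\sum_(j < k) lebesgue_measure (cylinder n j (h a) (h b)))%E.
  apply: (@measure_semi_additive_ord_I _ _ _ lebesgue_measure
    (fun j => cylinder n j (h a) (h b))).

  - by move=> j jk; have [] := Ij (Ordinal jk) (hj (Ordinal jk)).
  - by move=> i j _ _ [x [[_ <- _] [_ <- _]]].
  - by apply: bigsetU_measurable => j _; have [] := Ij j (hj j).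
rewrite (eq_bigr (fun j : 'I_k => (law n j * (j : nat)%:R * (h b - h a))%:E)).
  rewrite sumEFin -mulr_suml /= /h; congr EFin.
  by move: (\sum_(j < k) _) => s; field; lra.
by move=> j _; have [] := Ij j (hj j).
Qed.

End engel_measure.

Section engel_digits.
Context {R : realType}.
Implicit Types (x y : R) (e : nat -> nat).

Definition engel_partial e (N : nat) : R :=
  \sum_(1 <= n < N.+1) ((\prod_(1 <= k < n) ((e k)%:R - 1)) * (e n)%:R)^-1.

Definition shift e n := e n.+1.

Definition admissible e := (forall n, (1 <= n)%N -> (2 <= e n)%N) /\
  (forall n, (1 <= n)%N -> (e n + 1 <= e n.+1)%N).

Lemma admissible_shift e : admissible e -> admissible (shift e).
Proof. by move=> [e2 eS]; split => n n1; [exact: e2|exact: eS]. Qed.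

Lemma admissible_gt1 e n : admissible e -> (1 <= n)%N -> 1 < (e n)%:R :> R.
Proof. by move=> [e2 _] n1; rewrite ltr1n; exact: e2. Qed.

Lemma engel_partialS e N : engel_partial e N.+1 =
  (e 1%N)%:R^-1 + engel_partial (shift e) N / ((e 1%N)%:R - 1).
Proof.
rewrite /engel_partial big_nat_recl// big_geq// mul1r; congr (_ + _).
rewrite mulr_suml big_add1/= [RHS]big_add1/= .
apply: eq_bigr => i _; rewrite [in LHS]big_nat_recl// -invfM; congr (_^-1).
by rewrite [RHS]mulrC mulrA.
Qed.

Lemma engel_partial_ge0 e N : admissible e -> 0 <= engel_partial e N.
Proof.
move=> ae; rewrite /engel_partial big_nat; apply: sumr_ge0 => n /andP[n1 _].
rewrite invr_ge0 mulr_ge0// big_nat prodr_ge0// => k /andP[k1 _].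
by have := admissible_gt1 ae k1; lra.
Qed.

Lemma engel_partial_le e N : admissible e ->
  engel_partial e N <= ((e 1%N)%:R - 1)^-1.
Proof.
elim: N e => [|N IH] e ae; have e1 := admissible_gt1 ae (leqnn 1).
  by rewrite /engel_partial big_geq// invr_ge0; lra.
have as_ := admissible_shift ae.
rewrite engel_partialS; have {}IH := IH _ as_.
have e2 : (e 1%N)%:R <= (shift e 1)%:R - 1 :> R.
  by rewrite lerBrDr natr1 ler_nat -addn1; exact: ae.2.
have {}IH : engel_partial (shift e) N <= (e 1%N)%:R^-1.
  by apply: (le_trans IH); rewrite lef_pV2 ?posrE; lra.
move: (e 1%N)%:R e1 IH {e2} => E e1 IH.
rewrite [leRHS](_ : _ = E^-1 + E^-1 / (E - 1)); last by field; lra.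
by rewrite lerD2l ler_wpM2r// invr_ge0; lra.
Qed.

Lemma engel_expansion_ge x e : engel_expansion x e -> (e 1%N)%:R^-1 <= x.
Proof.
move=> [e2 eS ex]; have ae : admissible e by [].
have e1 := admissible_gt1 ae (leqnn 1).
rewrite -(cvg_lim _ ex)//; apply: limr_ge; first by apply/cvg_ex; exists x.
near=> N.
have -> : N = N.-1.+1 by rewrite prednK//; near: N; exact: nbhs_infty_gt.
rewrite -/(engel_partial e _) engel_partialS lerDl divr_ge0//; last by lra.
exact/engel_partial_ge0/admissible_shift.
Unshelve. all: by end_near. Qed.

Lemma engel_expansion_le x e : engel_expansion x e -> x <= ((e 1%N)%:R - 1)^-1.
Proof.
move=> [e2 eS ex]; rewrite -(cvg_lim _ ex)//; apply: limr_le.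
  by apply/cvg_ex; exists x.
by apply: nearW => N; exact: engel_partial_le.
Qed.

Lemma engel_expansion_shift x e : engel_expansion x e ->
  engel_expansion (((e 1%N)%:R - 1) * (x - (e 1%N)%:R^-1)) (shift e).
Proof.
move=> [e2 eS ex]; have ae : admissible e by [].
have e1 := admissible_gt1 ae (leqnn 1).
have [s2 sS] := admissible_shift ae; split => //.
have -> : (fun N => \sum_(1 <= n < N.+1)
    ((\prod_(1 <= k < n) ((shift e k)%:R - 1)) * (shift e n)%:R)^-1) =
    (fun N => ((e 1%N)%:R - 1) * (engel_partial e N.+1 - (e 1%N)%:R^-1)) :> (R ^nat).
  apply/funext => N; rewrite engel_partialS addrAC subrr add0r mulrC mulfVK//.
  by lra.
apply: cvgMl_tmp; apply: cvgB; last exact: cvg_cst.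
by rewrite (cvg_shiftS (engel_partial e)).
Qed.

Lemma engel_expansion_digit1 x e : engel_expansion x e ->
  engel_digit x = e 1%N /\ engel_expansion (engel_rem x) (shift e).
Proof.
move=> ex; have [e2 eS _] := ex; have ae : admissible e by [].
have e1 := admissible_gt1 ae (leqnn 1).
have exs := engel_expansion_shift ex.
have s1 := admissible_gt1 (admissible_shift ae) (leqnn 1).
have d1 : engel_digit x = e 1%N.
  apply: engel_digit_eq; [exact: e2| |exact: engel_expansion_le].
  rewrite -subr_gt0 -(@pmulr_rgt0 _ ((e 1%N)%:R - 1)); last by lra.
  by apply: lt_le_trans (engel_expansion_ge exs); rewrite invr_gt0; lra.
by split => //; rewrite /engel_rem d1.
Qed.

Lemma engel_expansion_unique x e n : engel_expansion x e -> (1 <= n)%N ->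
  e n = digit x n.
Proof.
case: n => // n ex _; elim: n x e ex => [|n IH] x e ex.
  by have [<- _] := engel_expansion_digit1 ex.
have [_ /IH H] := engel_expansion_digit1 ex.
by rewrite [LHS]H /= /remainder -iterSr.
Qed.

Lemma engel_expansion_digits x : 0 < x <= 1 -> engel_expansion x (digit x).
Proof.
move=> x01.
have dn n : (n < digit x n)%N.
  elim: n => [|n IH]; first by [].
  exact: leq_ltn_trans IH (digit_lt n x01).
have ae : admissible (digit x).
  split => n n1; first exact: leq_ltn_trans n1 (dn n).
  by rewrite addn1; exact: digit_lt.
have [d2 dS] := ae; split => //.
pose P N : R := \prod_(1 <= k < N.+1) ((digit x k)%:R - 1).
have P1 N : 1 <= P N.
  rewrite /P; elim: N => [|N IH]; first by rewrite big_geq.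
  rewrite big_nat_recr//= mulr_ege1// lerBrDr -[1 + 1]/(2%:R) ler_nat.
  exact: (d2 N.+1).
have PS N : P N.+1 = P N * ((digit x N.+1)%:R - 1).
  by rewrite /P big_nat_recr.
have E N : x - engel_partial (digit x) N = remainder x N / P N.
  elim: N => [|N IH].
    by rewrite /engel_partial /P !big_geq// subr0 invr1 mulr1.
  have dg := admissible_gt1 ae (isT : (1 <= N.+1)%N).
  have PN := P1 N.
  rewrite /engel_partial big_nat_recr// opprD addrA -/(engel_partial _ _) IH.
  rewrite -/(P N) PS.
  have -> : remainder x N.+1 = ((digit x N.+1)%:R - 1) *
    (remainder x N - (digit x N.+1)%:R^-1) by [].
  move: (digit x N.+1)%:R (P N) (remainder x N) dg PN => a p r a1 p1.
  by field; lra.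
have lim : remainder x N / P N @[N --> \oo] --> 0.
  apply: (squeeze_cvgr _ (cvg_cst 0) (@cvg_harmonic R)).
  apply: nearW => N; have [d1 /andP[r0 rd]] := remainder_bounds N x01.
  have PN := P1 N; rewrite divr_ge0 ?(ltW r0)//=; last by lra.
  rewrite ler_pdivrMr; last by lra.
  apply: (le_trans rd); rewrite -[leLHS]mulr1 ler_pM// lef_pV2 ?posrE ?ltr0n//.
  by rewrite ler_nat.
rewrite -[X in _ --> X]subr0.
have -> : (fun N => \sum_(1 <= n < N.+1) ((\prod_(1 <= k < n)
    ((digit x k)%:R - 1)) * (digit x n)%:R)^-1) =
    (fun N => x - remainder x N / P N) :> (R^nat).
  by apply/funext => N; rewrite -E opprB addrC subrK.
by apply: cvgB => //; exact: cvg_cst.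
Qed.

Lemma engel_digitsE x n : 0 < x <= 1 -> (1 <= n)%N -> engel_digits x n = digit x n.
Proof.
move=> x01 n1; apply: engel_expansion_unique => //.
by apply: (@xgetPex _ (fun=> 0%N) [set e | engel_expansion x e]);
  exists (digit x); exact: engel_expansion_digits.
Qed.

Lemma engel_digit_law n k : (1 <= n)%N -> (1 <= k)%N ->
  measurable (`]0, 1[ `&` [set x : R | engel_digits x n = k]) /\
  lebesgue_measure (`]0, 1[ `&` [set x : R | engel_digits x n = k]) =
  (law n k)%:E.
Proof.
move=> n1 k1; have k0 : 0 < k%:R :> R by rewrite ltr0n.
have kV : 0 <= k%:R^-1 :> R by rewrite invr_ge0 ltW.
have [mC lC] := @lebesgue_cylinder _ n k 0 k%:R^-1 (lexx 0) kV
  (eq_ind_r (fun z => z <= 1) (lexx 1) (mulVf (lt0r_neq0 k0))).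
have -> : `]0, 1[ `&` [set x : R | engel_digits x n = k] =
    cylinder n k 0 k%:R^-1 `\ 1.
  apply/seteqP; split => x /=; rewrite ?in_itv/=.
    move=> [/andP[x0 x1]]; have x01 : 0 < x <= 1 by rewrite x0 ltW.
    rewrite engel_digitsE// => dk; have [_] := remainder_bounds n x01.
    by rewrite dk; split => //; apply/eqP; rewrite lt_eqF.
  move=> [[x01 dk _] /eqP xn1]; rewrite engel_digitsE//; split => //.
  by move/andP: x01 => [-> x1]; rewrite lt_neqAle xn1.
split; first exact: measurableD.
have m1 : measurable (cylinder n k 0 k%:R^-1 `&` [set 1 : R]) by exact: measurableI.
have C1 : lebesgue_measure (cylinder n k 0 k%:R^-1 `&` [set 1 : R]) = 0%E.
  apply: (@subset_measure0 _ _ _ lebesgue_measure _ [set 1 : R]) => //.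
  exact: lebesgue_measure_set1.
have H := measureDI (@lebesgue_measure R) mC (measurable_set1 (1 : R)).
rewrite [X in (_ + X)%E]C1 adde0 in H; apply: etrans (esym H) (etrans lC _).
by rewrite subr0 -mulrA mulfV ?gt_eqF// mulr1.
Qed.

Lemma engel_ldp : satisfies_LDP (@lebesgue_measure R) (`]0, 1[ : set R)
  (fun n x => (ln (engel_digits x n)%:R - n%:R) / n%:R) (@I_C R).
Proof.
apply: (@ldp_of_law _ _ _ lebesgue_measure _ (fun n x => engel_digits x n)) => //.
- apply: etrans (lebesgue_measure_itv `]0, 1[) _.
  by rewrite /= lte_fin ltr01 oppr0 adde0.
- by move=> n k n1 k1; have [] := engel_digit_law n1 k1.
- by move=> n k n1 k1; have [] := engel_digit_law n1 k1.
Qed.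

End engel_digits.

(** * Record times *)

Section records.
Context {R : realType}.
Implicit Types (x : nat -> R) (n m k : nat).

Definition is_record x k : bool := all (fun i => x i < x k) (index_iota 1 k).

Definition records x m : nat := \sum_(1 <= k < m.+1) is_record x k.

Lemma is_recordP x k :
  reflect (forall i, (1 <= i)%N -> (i < k)%N -> x i < x k) (is_record x k).
Proof.
apply: (iffP allP) => [H i i1 ik|H i]; first by apply: H; rewrite mem_index_iota i1.
by rewrite mem_index_iota => /andP[]; exact: H.
Qed.

Lemma records0 x : records x 0 = 0%N.
Proof. by rewrite /records big_geq. Qed.

Lemma recordsS x m : records x m.+1 = (records x m + is_record x m.+1)%N.
Proof. by rewrite /records big_nat_recr. Qed.

Lemma is_record1 x : is_record x 1.
Proof. by apply/is_recordP => i; case: i. Qed.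

Lemma record_time_opt_last x m :
  exists2 j, record_time_opt x (records x m.+1).-1 = Some j
  & (1 <= j <= m.+1)%N /\ forall i, (1 <= i)%N -> (i <= m.+1)%N -> x i <= x j.
Proof.
elim: m => [|m [j jE [/andP[j1 jm] jmax]]].
  exists 1%N; first by rewrite recordsS records0 is_record1.
  by split => // i i1 i2; have -> : i = 1%N by lia.
have r0 : (0 < records x m.+1)%N.
  by rewrite /records big_nat_recl// is_record1.
rewrite recordsS; case: (is_recordP x m.+2) => [rec|nrec].
  exists m.+2; last first.
    split; first by rewrite leqnn.
    move=> i i1; rewrite leq_eqVlt => /orP[/eqP ->//|im].
    by rewrite ltW// rec.
  rewrite addn1 /= -(prednK r0) /= jE /= /next_record.
  case: pselect => [ex|]; last first.
    by case; exists m.+2; rewrite ltnS jm rec.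
  congr Some; case: ex_minnP => i /andP[ji xji] imin.
  apply/eqP; rewrite eqn_leq imin ?rec ?ltnS ?jm//= leqNgt; apply/negP => im.
  by move: xji; rewrite ltNge jmax//; lia.
exists j; first by rewrite addn0.
split; first by rewrite j1 leqW.
move=> i i1; rewrite leq_eqVlt => /orP[/eqP ->|im]; last exact: jmax.
rewrite leNgt; apply/negP => xj; apply: nrec => l l1 lm.
by apply: le_lt_trans xj; exact: jmax.
Qed.

Lemma record_time_opt_some x n k : record_time_opt x n = Some k ->
  [/\ (1 <= k)%N, is_record x k & records x k = n.+1].
Proof.
elim: n k => [|n IH] k /=.
  by move=> [<-]; rewrite recordsS records0 is_record1.
case jE : record_time_opt => [j|//] /=; have [j1 rj recj] := IH _ jE.
rewrite /next_record; case: pselect => // ex [].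
case: ex_minnP => i /andP[ji xji] imin <-{k}.
have before l : (j < l)%N -> (l < i)%N -> x l <= x j.
  move=> jl li; rewrite leNgt; apply/negP => xjl.
  by have := imin l; rewrite jl xjl => /(_ isT); rewrite leqNgt li.
have ri : is_record x i.
  apply/is_recordP => l l1 li; apply: le_lt_trans xji.
  have [lj|jl|->//] := ltngtP l j; last exact: before.
  by rewrite ltW//; move/is_recordP : rj; exact.
split => //; first exact: leq_trans ji.
have -> : i = i.-1.+1 by lia.
rewrite recordsS prednK ?ri ?addn1; last by lia.
congr S; rewrite -recj.
have : (j <= i.-1)%N by lia.
have : (i.-1 < i)%N by lia.
elim: i.-1 => [|l IHl] li jl; first by have -> : j = 0%N by lia.
have [->//|jl'] := eqVneq j l.+1.
rewrite recordsS IHl; [|lia|lia].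
case: is_recordP => [H|]; last by rewrite addn0.
have := H j j1; rewrite ltNge before//; last by lia.
by move=> /(_ ltac:(lia)).
Qed.

Lemma record_timeE x n k : (1 <= k)%N ->
  record_time x n = k <-> is_record x k /\ records x k = n.+1.
Proof.
move=> k1; rewrite /record_time; split.
  case E : record_time_opt => [j|] /= jk; last by rewrite -jk in k1.
  by subst j; have [] := record_time_opt_some E.
case: k k1 => // k _ [/is_recordP rk kn].
have [j] := record_time_opt_last x k; rewrite kn /= => -> [/andP[j1 jk] jmax] /=.
apply/eqP; rewrite eqn_leq jk leqNgt; apply/negP => lt.
by have := rk j j1 lt; rewrite ltNge jmax.
Qed.

End records.

Section power_sums.
Context {R : realType}.
Implicit Types (x : R) (m N : nat).

Lemma exprS_sub_bounds x m : 0 <= x ->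
  m.+1%:R * x ^+ m <= (x + 1) ^+ m.+1 - x ^+ m.+1 <= m.+1%:R * (x + 1) ^+ m.
Proof.
move=> x0; elim: m => [|m /andP[IHl IHr]].
  by rewrite !expr0 !expr1 !mulr1 addrAC subrr add0r lexx.
have xm : 0 <= x ^+ m.+1 by rewrite exprn_ge0.
have xm1 : 0 <= (x + 1) ^+ m by rewrite exprn_ge0// addr_ge0.
rewrite -natr1; apply/andP; split.
  have -> : (x + 1) ^+ m.+2 - x ^+ m.+2 =
    (x + 1) * ((x + 1) ^+ m.+1 - x ^+ m.+1) + x ^+ m.+1 by rewrite !exprS; ring.
  have H : (x + 1) * (m.+1%:R * x ^+ m) <= (x + 1) * ((x + 1) ^+ m.+1 - x ^+ m.+1).
    by rewrite ler_wpM2l// addr_ge0.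
  have : 0 <= m.+1%:R * x ^+ m by rewrite mulr_ge0// exprn_ge0.
  by move: H; rewrite !(exprS x); lra.
have -> : (x + 1) ^+ m.+2 - x ^+ m.+2 =
  x * ((x + 1) ^+ m.+1 - x ^+ m.+1) + (x + 1) ^+ m.+1 by rewrite !exprS; ring.
have H : x * ((x + 1) ^+ m.+1 - x ^+ m.+1) <= x * (m.+1%:R * (x + 1) ^+ m).
  by rewrite ler_wpM2l.
have : 0 <= m.+1%:R * (x + 1) ^+ m by rewrite mulr_ge0.
by move: H; rewrite !(exprS (x + 1)); lra.
Qed.

Lemma power_sum_ge m N : N%:R ^+ m.+1 <= m.+1%:R * \sum_(i < N) i.+1%:R ^+ m :> R.
Proof.
elim: N => [|N IH]; first by rewrite big_ord0 mulr0 expr0n.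
rewrite big_ord_recr /= mulrDr.
by have /andP[_] := @exprS_sub_bounds N%:R m (ler0n _ _); rewrite natr1; lra.
Qed.

Lemma power_sum_le m N : m.+1%:R * \sum_(i < N) i.+1%:R ^+ m <= N.+1%:R ^+ m.+1 :> R.
Proof.
elim: N => [|N IH]; first by rewrite big_ord0 mulr0 exprn_ge0.
rewrite big_ord_recr /= mulrDr.
by have /andP[+ _] := @exprS_sub_bounds N.+1%:R m (ler0n _ _); rewrite natr1; lra.
Qed.

End power_sums.

Section discretization.
Context {d : measure_display} {T : measurableType d} {R : realType}.
Variables (P : probability T R) (Y : T -> R) (F : R -> R) (G : R -> set T).
Variables (U : set T) (a t : R) (m : nat).
Hypotheses (mY : measurable_fun setT Y) (Fcont : continuous F).
Hypotheses (FNy : F x @[x --> -oo] --> 0).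
Hypothesis FE : forall u, P (Y @^-1` `]-oo, u]) = (F u)%:E.
Hypotheses (mG : forall u, measurable (G u)) (mU : measurable U).
Hypothesis PG : forall u (B : set R), measurable B ->
  P (G u `&` Y @^-1` B) = ((a * F u ^+ m)%:E * P (Y @^-1` B))%E.
Hypothesis UY : forall w, U w -> Y w <= t.
Hypothesis UG : forall w v, U w -> Y w <= v -> G v w.
Hypothesis GU : forall w u, G u w -> u < Y w -> Y w <= t -> U w.
Hypothesis a0 : 0 <= a.

Let mYB B : measurable B -> measurable (Y @^-1` B).
Proof. by move=> mB; rewrite -[X in measurable X]setTI; exact: mY. Qed.

Let F_ge0 u : 0 <= F u.
Proof. by rewrite -lee_fin -FE. Qed.

Let F_mono u v : u <= v -> F u <= F v.
Proof.
move=> uv; rewrite -lee_fin -!FE le_measure ?inE//; [exact: mYB..|].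
by move=> w /=; rewrite !in_itv/= => /le_trans; exact.
Qed.

Let PYoc u v : u <= v -> P (Y @^-1` `]u, v]) = (F v - F u)%:E.
Proof.
move=> uv.
have H : P (Y @^-1` `]-oo, v]) = (P (Y @^-1` `]-oo, u]) + P (Y @^-1` `]u, v]))%E.
  rewrite -measureU; [|exact: mYB|exact: mYB|].
    congr (P _); apply/seteqP; split => w /=; rewrite !in_itv/=.
      by move=> ->; rewrite andbT; case: (leP (Y w) u) => ?; [left|right].
    by move=> [/le_trans|/andP[//]]; exact.
  apply/seteqP; split => w //= []; rewrite !in_itv/= => wu /andP[uw _].
  by have := lt_le_trans uw wu; rewrite ltxx.
move: H; rewrite !FE; case: (P _) => [r| |]// [] H.
by congr EFin; lra.
Qed.

Let quantile v : 0 < v <= F t -> exists2 u, u <= t & F u = v.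
Proof.
move=> /andP[v0 vF].
have [s [st Fs]] : exists s, s <= t /\ F s <= v.
  have /cvgrPdist_le/(_ _ v0) Fv := FNy.
  have [M [_ HM]] := Fv.
  exists (Num.min t (M - 1)); split; first by rewrite ge_min lexx.
  have := HM (Num.min t (M - 1)); rewrite sub0r normrN ger0_norm//; apply.
  by rewrite gt_min; apply/orP; right; lra.
have ivt : Num.min (F s) (F t) <= v <= Num.max (F s) (F t).
  by rewrite (min_idPl (F_mono st)) (max_idPr (F_mono st)) Fs.
have [u] := IVT st (continuous_subspaceT Fcont) ivt.
by rewrite in_itv/= => /andP[_ ut] Fu; exists u.
Qed.

Lemma measure_discretization : P U = (a * F t ^+ m.+1 / m.+1%:R)%:E.
Proof.
have PU : P U \is a fin_num by exact: fin_num_measure.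
have [F0|Fneq0] := eqVneq (F t) 0.
  rewrite F0 expr0n/= mulr0 mul0r.
  have Yt0 : P (Y @^-1` `]-oo, t]) = 0%E by rewrite FE F0.
  apply: (subset_measure0 mU (mYB (measurable_itv `]-oo, t])) _ Yt0).
  by move=> w Uw /=; rewrite in_itv/=; exact: UY.
have F0 : 0 < F t by rewrite lt_neqAle eq_sym Fneq0 F_ge0.
suff H N : (0 < N)%N ->
    `|fine (P U) - a * F t ^+ m.+1 / m.+1%:R| <= a * F t ^+ m.+1 / N%:R.
  set r := a * F t ^+ m.+1 in H *.
  have r0 : 0 <= r by rewrite mulr_ge0// exprn_ge0.
  rewrite -[LHS]fineK//; congr EFin; apply/eqP; rewrite -subr_eq0 -normr_le0.
  apply/ler_addgt0Pr => e e0; rewrite add0r.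
  apply: (le_trans (H (Num.truncn (r / e)).+1 _)) => //.
  rewrite ler_pdivrMr ?ltr0n// mulrC -ler_pdivrMr//.
  by apply/ltW/truncnS_gt.
case: N => // N _.
have N0 : 0 < N.+1%:R :> R by rewrite ltr0n.
have [tau tauE] : exists tau : nat -> R, forall i, (1 <= i <= N.+1)%N ->
    [/\ tau i <= t, F (tau i) = F t * (i%:R / N.+1%:R) & i = N.+1 -> tau i = t].
  suff /choice[tau Htau] : forall i, exists u, (1 <= i <= N.+1)%N ->
    [/\ u <= t, F u = F t * (i%:R / N.+1%:R) & i = N.+1 -> u = t] by exists tau.
  move=> i; have [->|iN] := eqVneq i N.+1.
    by exists t => _; split => //; rewrite divff ?gt_eqF// mulr1.
  have [i1N|i1N] := boolP (1 <= i <= N.+1)%N; last by exists t.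
  have [|u ut Fu] := @quantile (F t * (i%:R / N.+1%:R)).
    move/andP: i1N => [i1 iN']; rewrite mulr_gt0 ?divr_gt0 ?ltr0n//=.
    by rewrite ler_piMr// ler_pdivrMr// mul1r ler_nat.
  by exists u => _; split => // E; rewrite E eqxx in iN.
have tau_le i : (i <= N)%N -> tau i.+1 <= t.
  by move=> iN; have [|] := tauE i.+1; rewrite ?ltnS.
have Ftau i : (i <= N)%N -> F (tau i.+1) = F t * (i.+1%:R / N.+1%:R).
  by move=> iN; have [|] := tauE i.+1; rewrite ?ltnS.
have tauN : tau N.+1 = t.
  by have [|_ _ ->//] := tauE N.+1; rewrite leqnn.
have tau_mono i : (i < N)%N -> tau i.+1 <= tau i.+2.
  move=> iN; rewrite leNgt; apply/negP => /ltW/F_mono; apply/negP; rewrite -ltNge.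
  by rewrite !Ftau// 1?ltnW// ltr_pM2l// ltr_pM2r ?invr_gt0// ltr_nat.
pose cell i : set R :=
  if i is 0 then `]-oo, tau 1%N]%classic else `]tau i, tau i.+1]%classic.
have mcell i : measurable (cell i) by case: i => [|i]; exact: measurable_itv.
have Pcell i : (i < N.+1)%N -> P (Y @^-1` cell i) = (F t / N.+1%:R)%:E.
  case: i => [_|i iN] /=.
    by rewrite FE Ftau// mul1r.
  rewrite PYoc; last exact: tau_mono.
  rewrite !Ftau// 1?ltnW//.
  by congr EFin; rewrite -mulrBr -mulrBl -(natr1 i.+1) addrAC subrr add0r mul1r.
pose s : R := a * F t ^+ m.+1 / N.+1%:R ^+ m.+1.
have PGcell i j : (i <= N)%N -> (j <= N)%N ->
    P (G (tau i.+1) `&` Y @^-1` cell j) = (s * i.+1%:R ^+ m)%:E.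
  move=> iN jN; rewrite PG// Pcell// Ftau//.
  rewrite -EFinM; congr EFin; rewrite /s !exprMn !exprS exprVn.
  by field; rewrite expf_neq0 gt_eqF.
have upper : (P U <= (s * \sum_(i < N.+1) i.+1%:R ^+ m)%:E)%E.
  pose V i := G (tau i.+1) `&` Y @^-1` cell i.
  have mV i : measurable (V i) by apply: measurableI => //; exact: mYB.
  apply: (@le_trans _ _ (P (\big[setU/set0]_(i < N.+1) V i))).
    apply: le_measure; rewrite ?inE//; first exact: bigsetU_measurable.
    rewrite -bigcup_mkord => w Uw.
    have ex : exists i, (i < N.+1)%N && (Y w <= tau i.+1).
      exists N; rewrite ltnSn tauN; exact: UY.
    case: (ex_minnP ex) => i /andP[iN Yi] imin; exists i => //.
    split; first exact: UG Uw Yi.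
    case: i iN Yi imin => [|i] iN Yi imin /=; rewrite in_itv/= Yi ?andbT//.
    rewrite ltNge; apply/negP => Yi'.
    by have := imin i; rewrite Yi' (ltnW iN) => /(_ isT); rewrite ltnn.
  apply: (le_trans (Boole_inequality P _)) => //.
  rewrite mulr_sumr -sumEFin; apply: lee_sum => i _.
  by rewrite le_eqVlt; apply/orP; left; apply/eqP; apply: PGcell; rewrite -ltnS.
have lower : ((s * \sum_(i < N) i.+1%:R ^+ m)%:E <= P U)%E.
  pose W i := G (tau i.+1) `&` Y @^-1` cell i.+1.
  have mW i : measurable (W i) by apply: measurableI => //; exact: mYB.
  rewrite mulr_sumr -sumEFin.
  rewrite (eq_bigr (fun i : 'I_N => P (W i))); last first.
    by move=> i _; rewrite /W PGcell// ltnW.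
  rewrite -(@measure_semi_additive_ord_I _ _ _ P W)//.
  - apply: le_measure; rewrite ?inE//; first exact: bigsetU_measurable.
    rewrite -bigcup_mkord => w [i /= iN [Gw]] /=; rewrite in_itv/= => /andP[lt le].
    by apply: GU Gw lt _; apply: le_trans le _; exact: tau_le.
  - have Wcell i j w : (i < j)%N -> (j < N)%N -> W i w -> W j w -> False.
      move=> ij jN [_] /=; rewrite in_itv/= => /andP[_ le] [_] /=.
      rewrite in_itv/= => /andP[lt _].
      suff : tau i.+2 <= tau j.+1
        by move=> /(le_trans le)/(lt_le_trans lt); rewrite ltxx.
      elim: j ij jN {lt} => // j IH; rewrite ltnS leq_eqVlt => /orP[/eqP ->//|ij] jN.
      by apply: le_trans (IH ij (ltnW jN)) _; apply: tau_mono; exact: ltnW.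
    move=> i j /= iN jN [w [Wi Wj]].
    by have [/Wcell/(_ jN Wi Wj)|/Wcell/(_ iN Wj Wi)|] := ltngtP i j.
  - exact: bigsetU_measurable.
have pl := @power_sum_le R m N; have pu := @power_sum_ge R m N.+1.
rewrite -(fineK PU) !lee_fin in upper lower.
set r := a * F t ^+ m.+1.
have r0 : 0 <= r by rewrite mulr_ge0// exprn_ge0.
have s0 : 0 <= s by rewrite /s divr_ge0 ?exprn_ge0.
have sr : s * N.+1%:R ^+ m.+1 = r by rewrite /s /r mulfVK// expf_neq0 gt_eqF.
have m0 : 0 < m.+1%:R :> R by rewrite ltr0n.
have lr : s * \sum_(i < N) i.+1%:R ^+ m <= r / m.+1%:R.
  by rewrite ler_pdivlMr// -sr mulrC mulrCA ler_wpM2l.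
have ru : r / m.+1%:R <= s * \sum_(i < N.+1) i.+1%:R ^+ m.
  by rewrite ler_pdivrMr// -sr [leRHS]mulrC mulrCA ler_wpM2l.
have gap : s * \sum_(i < N.+1) i.+1%:R ^+ m =
    s * \sum_(i < N) i.+1%:R ^+ m + r / N.+1%:R.
  rewrite big_ord_recr/= mulrDr; congr (_ + _).
  by rewrite -sr exprS; field; rewrite gt_eqF.
rewrite gap in upper ru; move: (s * _) lr ru lower upper => S lr ru lower upper.
move: (r / m.+1%:R) (r / N.+1%:R) (fine (P U)) lr ru lower upper => x y z *.
by rewrite ler_norml; apply/andP; split; lra.
Qed.

End discretization.

Section record_law.
Context {d : measure_display} {T : measurableType d} {R : realType}.
Variables (P : probability T R) (X : nat -> {RV P >-> R}).
Hypotheses (Xindep : mutually_independent X) (Xid : identically_distributed X).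
Hypothesis Xcont : forall n, (1 <= n)%N -> continuous (cdf (X n)).
Implicit Types (B : nat -> set R) (m n r K : nat).

Let F t : R := fine (cdf (X 1) t).

Let mX i (C : set R) : measurable C -> measurable (X i @^-1` C).
Proof.
by move=> mC; rewrite -[Y in measurable Y]setTI; exact: (measurable_funPT (X i)).
Qed.

Let PX i (t : R) : (1 <= i)%N -> P (X i @^-1` `]-oo, t]) = (F t)%:E.
Proof.
move=> i1; rewrite /F fineK ?fin_num_measure//.
exact: (Xid i1 (leqnn 1) (measurable_itv `]-oo, t])).
Qed.

Let Fcont : continuous F.
Proof.
move=> t; apply: fine_cvg; rewrite fineK ?fin_num_measure//.
exact: Xcont.
Qed.

Let FNy : F x @[x --> -oo] --> 0.
Proof. by apply: fine_cvg; exact: cvg_cdfNy0. Qed.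

Let Fy : F x @[x --> +oo] --> (1 : R).
Proof. by apply: fine_cvg; exact: cvg_cdfy1. Qed.

Let path w i : R := X i w.

Definition future m K B : set T :=
  [set w | forall j, (m < j)%N -> (j <= K)%N -> B j (X j w)].

Definition record_event m r (t : R) : set T :=
  [set w | records (path w) m = r /\ forall i, (1 <= i)%N -> (i <= m)%N -> X i w <= t].

Let futureE m K B : future m K B =
  \bigcap_(j in [set j | (m < j <= K)%N]) (X j @^-1` B j).
Proof.
apply/seteqP; split => w H j; first by move=> /andP[mj jK]; exact: H.
by move=> mj jK; apply: (H j) => /=; rewrite mj.
Qed.

Let mfuture m K B : (forall j, measurable (B j)) -> measurable (future m K B).
Proof.
by move=> mB; rewrite futureE; apply: bigcap_measurableType => j _; exact: mX.
Qed.

Let Pfuture0 K B : (forall j, measurable (B j)) ->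
  P (future 0 K B) = (\prod_(1 <= j < K.+1) P (X j @^-1` B j))%E.
Proof.
move=> mB; pose J : {fset nat} := [fset j in index_iota 1 K.+1]%fset.
have memJ j : (j \in J) = (0 < j <= K)%N by rewrite !inE/= mem_index_iota ltnS.
have -> : future 0 K B = \bigcap_(j in [set` J]) (X j @^-1` B j).
  rewrite futureE (_ : [set j | _] = [set` J])//.
  by apply/seteqP; split => j /=; rewrite memJ.
rewrite Xindep//; last by move=> j; rewrite memJ => /andP[].
apply: perm_big; apply: uniq_perm; rewrite ?fset_uniq ?iota_uniq// => j.
by rewrite memJ mem_index_iota ltnS.
Qed.

Let mrecord k : measurable [set w | is_record (path w) k].
Proof.
have -> : [set w | is_record (path w) k] =
    \bigcap_(i in [set i | (1 <= i < k)%N]) [set w | X i w < X k w].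
  apply/seteqP; split => w /=.
    by move=> /is_recordP H i /andP[i1 ik]; exact: H.
  by move=> H; apply/is_recordP => i i1 ik; apply: (H i); rewrite /= i1.
apply: bigcap_measurableType => i _.
have := measurable_realfun.measurable_funB (measurable_funPT (X k))
  (measurable_funPT (X i)).
move=> /(_ measurableT _ (measurable_itv `]0, +oo[)); rewrite setTI.
rewrite [X in _ -> measurable X](_ : _ = (X k \- X i) @^-1` `]0, +oo[)//.
by apply/seteqP; split => w /=; rewrite in_itv/= subr_gt0 andbT.
Qed.

Let mrecords m r : measurable [set w | records (path w) m = r].
Proof.
elim: m r => [|m IH] r.
  have [->|r0] := eqVneq r 0%N.
    rewrite (_ : [set _ | _] = setT)//.
    by apply/seteqP; split => w // _; rewrite /= records0.
  rewrite (_ : [set _ | _] = set0)//; apply/seteqP; split => w //=.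
  by rewrite records0 => /esym/eqP; rewrite (negbTE r0).
pose rec := [set w | is_record (path w) m.+1].
have -> : [set w | records (path w) m.+1 = r] =
    ([set w | records (path w) m = r] `\` rec) `|`
    (if r is r'.+1 then [set w | records (path w) m = r'] `&` rec else set0).
  apply/seteqP; split => w /=; rewrite recordsS /rec.
    case E : is_record => H.
      by right; rewrite addn1 in H; case: r H => // r [Hr]; split.
    by left; rewrite addn0 in H; split => //=; rewrite E.
  case=> [[-> /negP/negbTE ->]|]; first by rewrite addn0.
  by case: r => // r [/= -> ->]; rewrite addn1.
apply: measurableU; first by apply: measurableD; [exact: IH|exact: mrecord].
by case: r => [|r]; [exact: measurable0|apply: measurableI; [exact: IH|exact: mrecord]].
Qed.

Let mrecord_event m r t : measurable (record_event m r t).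
Proof.
have -> : record_event m r t = [set w | records (path w) m = r] `&`
    \bigcap_(i in [set i | (1 <= i <= m)%N]) (X i @^-1` `]-oo, t]).
  apply/seteqP; split => w [rw H]; split => // i.
    by move=> /= /andP[i1 im]; rewrite in_itv/=; exact: H.
  by move=> i1 im; have := H i; rewrite /= in_itv /= i1 im; exact.
apply: measurableI => //; apply: bigcap_measurableType => i _.
by apply: mX; exact: measurable_itv.
Qed.

(* Probability of [r] records among the first [m] observations. *)
Definition record_count_law m r : R := m.+1%:R * law r m.+1.

Lemma record_count_lawS m r : record_count_law m.+1 r =
  record_count_law m r * (1 - m.+1%:R^-1) +
  (if r is r'.+1 then record_count_law m r' / m.+1%:R else 0).
Proof.
rewrite /record_count_law; case: r => [|r].
  rewrite /= mulr0 addr0; case: m => [|m]; first by rewrite invr1 subrr mulr0.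
  by rewrite !mulr0 mul0r.
rewrite [law _ m.+2]/= [law r.+1 m.+1]/= (big_ord_recr m.+1)/=.
case: m => [|m].
  by rewrite big_ord1 mulr0 add0r invr1 subrr mulr0 add0r; field.
rewrite -(natr1 m.+2) -(natr1 m.+1).
have : 0 < m.+1%:R :> R by rewrite ltr0n.
move: m.+1%:R (\sum_(j < _) _) => a S a0.
by field; lra.
Qed.

Definition record_event_law m := forall r t K B, (m <= K)%N ->
  (forall j, measurable (B j)) ->
  P (record_event m r t `&` future m K B) =
  ((record_count_law m r * F t ^+ m)%:E *
   \prod_(m.+1 <= j < K.+1) P (X j @^-1` B j))%E.

Definition record_at m r t : set T :=
  [set w | [/\ records (path w) m = r, is_record (path w) m.+1 & X m.+1 w <= t]].

Let mrecord_at m r t : measurable (record_at m r t).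
Proof.
have -> : record_at m r t = [set w | records (path w) m = r] `&`
    ([set w | is_record (path w) m.+1] `&` X m.+1 @^-1` `]-oo, t]).
  apply/seteqP; split => w /=; rewrite in_itv/=; first by case.
  by case=> ? [].
apply: measurableI; first exact: mrecords.
by apply: measurableI; [exact: mrecord|apply: mX; exact: measurable_itv].
Qed.

Let prob_prod m K B : (forall j, measurable (B j)) -> exists2 p : R, 0 <= p &
  (\prod_(m.+1 <= j < K.+1) P (X j @^-1` B j) = p%:E)%E.
Proof.
move=> mB; elim/big_ind : _ => [|x y [p p0 ->] [q q0 ->]|j _].
- by exists 1.
- by exists (p * q) => //; exact: mulr_ge0.
exists (fine (P (X j @^-1` B j))); first exact: fine_ge0.
by rewrite fineK// fin_num_measure//; exact: mX.
Qed.

Lemma record_at_law m r t K B : record_event_law m -> (m < K)%N ->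
  (forall j, measurable (B j)) ->
  P (record_at m r t `&` future m.+1 K B) =
  ((record_count_law m r * F t ^+ m.+1 / m.+1%:R)%:E *
   \prod_(m.+2 <= j < K.+1) P (X j @^-1` B j))%E.
Proof.
move=> IH mK mB; have [p p0 pE] := prob_prod m.+1 K mB; rewrite pE -EFinM.
rewrite (@measure_discretization _ _ _ P (X m.+1) F
  (fun u => record_event m r u `&` future m.+1 K B) _ (record_count_law m r * p) t m)//.
- by congr EFin; ring.
- by move=> u; exact: PX.
- by move=> u; apply: measurableI; [exact: mrecord_event|exact: mfuture].
- by apply: measurableI; [exact: mrecord_at|exact: mfuture].
- move=> u C mC; pose B' j := if j == m.+1 then C else B j.
  have mB' j : measurable (B' j) by rewrite /B'; case: ifP.
  have -> : record_event m r u `&` future m.+1 K B `&` X m.+1 @^-1` C =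
      record_event m r u `&` future m K B'.
    apply/seteqP; split => w.
      move=> [[Ew Cw] Yw]; split => // j mj jK; rewrite /B'; case: eqP => [->//|jm].
      by apply: Cw => //; lia.
    move=> [Ew Cw]; split; last by have := Cw m.+1 (leqnn _) mK; rewrite /B' eqxx.
    split => // j mj jK; have := Cw j (ltnW mj) jK.
    by rewrite /B' (_ : (j == m.+1) = false)//; lia.
  rewrite IH//; last exact: ltnW.
  rewrite big_ltn// {1}/B' eqxx [X in (_ * (_ * X))%E](_ : _ = p%:E).
    by rewrite muleCA muleC -EFinM mulrAC.
  rewrite -pE big_nat [RHS]big_nat; apply: eq_bigr => j /andP[mj _].
  by rewrite /B' (_ : (j == m.+1) = false)//; lia.
- by move=> w [[]].
- move=> w v [[rw /is_recordP rec Yt] Cw] Yv; split => //; split => // i i1 im.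
  by apply: le_trans Yv; apply: ltW; exact: rec.
- move=> w u [[rw H] Cw] uY Yt; split => //; split => //.
  by apply/is_recordP => i i1 im; apply: le_lt_trans uY; exact: H.
- by rewrite mulr_ge0// mulr_ge0// law_ge0.
Qed.

Lemma record_event_future m : record_event_law m.
Proof.
elim: m => [|m IH] r t K B mK mB.
  rewrite expr0 mulr1 /record_count_law mul1r /=.
  case: r => [|r]; last first.
    rewrite (_ : _ `&` _ = set0) ?measure0 ?(lawS1 r) ?mul0e//.
    by apply/seteqP; split => w // [[]]; rewrite records0.
  rewrite (_ : _ `&` _ = future 0 K B); first by rewrite Pfuture0// mul1e.
  apply/seteqP; split => w; first by case.
  by move=> Cw; split => //; split => [|i]; [rewrite records0|lia].
have [p p0 pE] := prob_prod m.+1 K mB; rewrite pE.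
pose B' j := if j == m.+1 then `]-oo, t]%classic else B j.
have mB' j : measurable (B' j) by rewrite /B'; case: ifP => // _; exact: measurable_itv.
pose D := record_event m r t `&` future m K B'.
have mD : measurable D by apply: measurableI; [exact: mrecord_event|exact: mfuture].
have PD : P D = (record_count_law m r * F t ^+ m.+1 * p)%:E.
  rewrite /D IH//; last exact: ltnW.
  rewrite big_ltn// {1}/B' eqxx PX// [X in (_ * (_ * X))%E](_ : _ = p%:E).
    by rewrite -!EFinM; congr EFin; rewrite exprS; ring.
  rewrite -pE big_nat [RHS]big_nat; apply: eq_bigr => j /andP[mj _].
  by rewrite /B' (_ : (j == m.+1) = false)//; lia.
pose U r' := record_at m r' t `&` future m.+1 K B.
have mUr r' : measurable (U r').
  by apply: measurableI; [exact: mrecord_at|exact: mfuture].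
have PUr r' : P (U r') = (record_count_law m r' * F t ^+ m.+1 / m.+1%:R * p)%:E.
  by rewrite record_at_law// pE -EFinM.
have UD : U r `<=` D.
  move=> w [[rw /is_recordP rec Yt] Cw]; split.
    by split => // i i1 im; apply: le_trans Yt; apply: ltW; exact: rec.
  move=> j mj jK; rewrite /B'; case: eqP => [->//|jm]; apply: Cw => //; lia.
have E : record_event m.+1 r t `&` future m.+1 K B =
    (D `\` U r) `|` (if r is r'.+1 then U r' else set0).
  apply/seteqP; split => w.
    move=> [[rw Ht] Cw]; move: rw; rewrite recordsS.
    case: (is_recordP (path w) m.+1) => [/is_recordP rec|nrec];
      rewrite ?addn1 ?addn0 => rw.
      right; case: r {PD UD D mD} rw => // r [rw].
      by split => //; split => //; exact: Ht.
    left; split; last by move=> [[_ /is_recordP]].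
    split; first by split => // i i1 im; apply: Ht => //; exact: leqW.
    move=> j mj jK; rewrite /B'; case: eqP => [->|jm]; last by apply: Cw => //; lia.
    by rewrite /= in_itv/=; exact: Ht.
  case=> [[[[rw Ht] Bw] nU]|].
    have Yt : X m.+1 w <= t by have := Bw m.+1 (leqnn _) mK; rewrite /B' eqxx /= in_itv.
    have Cw : future m.+1 K B w.
      move=> j mj jK; have := Bw j (ltnW mj) jK.
      by rewrite /B' (_ : (j == m.+1) = false)//; lia.
    have nrec : ~~ is_record (path w) m.+1 by apply/negP => rec; apply: nU.
    split => //; split; first by rewrite recordsS (negbTE nrec) addn0.
    move=> i i1; rewrite leq_eqVlt => /orP[/eqP ->//|im]; exact: Ht.
  case: r {PD UD D mD} => // r [[rw rec Yt] Cw]; split => //; split.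
    by rewrite recordsS rw rec addn1.
  move=> i i1; rewrite leq_eqVlt => /orP[/eqP ->//|im].
  by apply: le_trans Yt; apply: ltW; move/is_recordP : rec; exact.
have mif : measurable (if r is r'.+1 then U r' else set0).
  by case: (r) => // *; exact: measurable0.
have dis : (D `\` U r) `&` (if r is r'.+1 then U r' else set0) = set0.
  apply/seteqP; split => w // [[[[rw _] _] _]].
  case rE : r => [//|r'] [[rw' _ _] _].
  by move: rw; rewrite rw' rE => /eqP; rewrite ltn_eqF.
have mDU : measurable (D `\` U r) by apply: measurableD => //; exact: mUr.
have EU : P (record_event m.+1 r t `&` future m.+1 K B) =
    (P (D `\` U r) + P (if r is r'.+1 then U r' else set0))%E.
  by rewrite E; exact: measureU mDU mif dis.
have PU' : P (if r is r'.+1 then U r' else set0) =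
    (if r is r'.+1 then record_count_law m r' / m.+1%:R * F t ^+ m.+1 * p else 0)%:E.
  case: (r) => [|r']; first by rewrite measure0.
  by rewrite PUr; congr EFin; ring.
have PDU : P (D `\` U r) = (P D - P (U r))%E.
  have PDy : (P D < +oo)%E by rewrite PD ltry.
  by have := measureD mD (mUr r) PDy; rewrite setIidr.
rewrite EU PDU PU' PD PUr record_count_lawS -EFinB -EFinD -EFinM; congr EFin.
by case: (r) => [|r']; ring.
Qed.

Lemma record_time_law n k : (1 <= k)%N ->
  measurable [set w | record_time (fun j => X j w) n = k] /\
  P [set w | record_time (fun j => X j w) n = k] = (law n k)%:E.
Proof.
case: k => // m _; set A := [set w | _].
have AE : A = [set w | records (path w) m = n] `&` [set w | is_record (path w) m.+1].
  apply/seteqP; split => w /=.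
    by move=> /(record_timeE _ _ (ltn0Sn m))[rec]; rewrite recordsS rec addn1 => -[].
  move=> [rw rec]; apply/(record_timeE _ _ (ltn0Sn m)); split => //.
  by rewrite recordsS rec rw addn1.
have mA : measurable A.
  by rewrite AE; apply: measurableI; [exact: mrecords|exact: mrecord].
split => //; pose c := record_count_law m n / m.+1%:R.
have cE : c = law n m.+1 by rewrite /c /record_count_law mulrC mulKf.
have c0 : 0 <= c by rewrite cE law_ge0.
have PA : P A \is a fin_num by exact: fin_num_measure.
have PAt t : P (A `&` X m.+1 @^-1` `]-oo, t]) = (c * F t ^+ m.+1)%:E.
  have := @record_at_law m n t m.+1 (fun=> setT) (@record_event_future m) (leqnn _)
    (fun=> measurableT).
  rewrite big_geq// mule1 [X in P X](_ : _ = A `&` X m.+1 @^-1` `]-oo, t]).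
    by move=> ->; congr EFin; rewrite /c; ring.
  apply/seteqP; split => w; rewrite AE /= in_itv/=.
    by move=> [[rw rec Yt] _].
  by move=> [[rw rec] Yt]; split => // j.
have mXt t : measurable (X m.+1 @^-1` `]-oo, t]) by apply: mX; exact: measurable_itv.
have bounds t : c * F t ^+ m.+1 <= fine (P A) <= c * F t ^+ m.+1 + (1 - F t).
  rewrite -!lee_fin fineK//; apply/andP; split.
    by rewrite -PAt le_measure ?inE//; exact: measurableI.
  have PYt : P (~` (X m.+1 @^-1` `]-oo, t])) = (1 - F t)%:E.
    by rewrite probability_setC// PX// -EFinB.
  rewrite EFinD -PAt -PYt.
  have mC : measurable (~` (X m.+1 @^-1` `]-oo, t])) by exact: measurableC.
  have mAX : measurable (A `&` X m.+1 @^-1` `]-oo, t]) by exact: measurableI.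
  apply: le_trans (measureU2 P mAX mC); apply: le_measure; rewrite ?inE//.
    exact: measurableU.
  by move=> w Aw; have [Xw|Xw] := pselect ((X m.+1 @^-1` `]-oo, t]) w); [left|right].
have lim1 : c * F t ^+ m.+1 @[t --> +oo] --> c.
  rewrite -[X in _ --> X]mulr1 -[X in _ * X](expr1n _ m.+1).
  apply: cvgMl_tmp; apply: (@cvg_comp _ _ _ F (fun z => z ^+ m.+1)); first exact: Fy.
  exact: exprn_continuous.
have lim2 : c * F t ^+ m.+1 + (1 - F t) @[t --> +oo] --> c.
  rewrite -[X in _ --> X]addr0; apply: cvgD => //.
  by rewrite -[X in _ --> X](subrr 1); apply: cvgB => //; exact: cvg_cst.
have lim : (fun=> fine (P A)) @ (pinfty_nbhs R) --> c.
  by apply: (squeeze_cvgr _ lim1 lim2); exact: nearW.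
rewrite -[LHS]fineK// -cE; congr EFin.
exact: (cvg_unique _ (cvg_cst (fine (P A))) lim).
Qed.

Lemma record_time_ldp : satisfies_LDP P setT
  (fun n w => (ln (record_time (fun j => X j w) n)%:R - n%:R) / n%:R) (@I_C R).
Proof.
apply: (@ldp_of_law _ _ _ P _ (fun n w => record_time (fun j => X j w) n)) => //.
- exact: probability_setT.
- by move=> n k n1 k1; rewrite setTI; have [] := record_time_law n k1.
- by move=> n k n1 k1; rewrite setTI; have [] := record_time_law n k1.
Qed.

End record_law.

Theorem corollary1p4 (R : realType) :
  satisfies_LDP (@lebesgue_measure R) (`]0, 1[ : set R)
    (fun n x => (ln (engel_digits x n)%:R - n%:R) / n%:R)
    (@I_C R)
  /\
  (forall (d : measure_display) (T : measurableType d) (P : probability T R)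
      (X : nat -> {RV P >-> R}),
    mutually_independent X ->
    identically_distributed X ->
    (forall n, (1 <= n)%N -> continuous (cdf (X n))) ->
    satisfies_LDP P setT
      (fun n w => (ln (record_time (fun j => X j w) n)%:R - n%:R) / n%:R)
      (@I_C R)).
Proof.
split; first exact: engel_ldp.
move=> d T P X Xindep Xid Xcont; exact: record_time_ldp Xindep Xid Xcont.
Qed.
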